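(* Let $p$ be a prime and let $\mathsf{R}$ be a non-abelian free restricted $\mathbb{F}_p$-Lie algebra on finitely many generators. Then there exists, for each $\alpha\in[0,1]$, a graded restricted Lie subalgebra $\mathsf{S} \le \mathsf{R}$ that can be generated (as a restricted Lie algebra) by basic commutators and satisfies $\mathrm{den}_{\mathsf{R}}(\mathsf{S}) = \alpha$. In particular, $\mathrm{dspec}(\mathsf{R}) = [0,1]$.
   Context: $\mathsf{R}$ is the free restricted $\mathbb{F}_p$-Lie algebra, with $p$-map $\mathsf{u}\mapsto\mathsf{u}^{[p]}$, on $\mathsf{x}_1,\ldots,\mathsf{x}_d$, $d\ge2$. It can be realised as the restricted Lie subalgebra generated by $\mathsf{x}_1,\ldots,\mathsf{x}_d$ in the free associative algebra $\mathsf{A}=\mathbb{F}_p\langle\mathsf{x}_1,\ldots,\mathsf{x}_d\rangle$ with $[\mathsf{u},\mathsf{v}]=\mathsf{u}\mathsf{v}-\mathsf{v}\mathsf{u}$ and $\mathsf{u}^{[p]}=\mathsf{u}^p$; its natural grading is $\mathsf{R}=\bigoplus_{n\ge1}\mathsf{R}_n$, where $\mathsf{R}_n$ is the intersection of $\mathsf{R}$ with the span of all products of length $n$ in the generators. A subalgebra $\mathsf{S}$ is graded if $\mathsf{S}=\bigoplus_n(\mathsf{S}\cap\mathsf{R}_n)$. Write $\mathsf{R}_{>n}=\bigoplus_{m>n}\mathsf{R}_m$. The density of a restricted Lie subalgebra $\mathsf{S}\le\mathsf{R}$ is $$\mathrm{den}_{\mathsf{R}}(\mathsf{S}) = \liminf_{n\to\infty}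 \frac{\dim_{\mathbb{F}_p}\big((\mathsf{S}+\mathsf{R}_{>n})/\mathsf{R}_{>n}\big)}{\dim_{\mathbb{F}_p}(\mathsf{R}/\mathsf{R}_{>n})},$$ and $\mathrm{dspec}(\mathsf{R})=\{\mathrm{den}_{\mathsf{R}}(\mathsf{S})\mid \mathsf{S} \text{ a restricted Lie subalgebra of }\mathsf{R}\}$. Basic commutators (with respect to $X=\{\mathsf{x}_1,\ldots,\mathsf{x}_d\}$) are elements of the free Lie algebra generated by $X$ inside $\mathsf{R}$, defined inductively together with a well-order. Weight: $\mathrm{wt}(\mathsf{x}_i)=1$, $\mathrm{wt}([\mathsf{c}_1,\mathsf{c}_2])=\mathrm{wt}(\mathsf{c}_1)+\mathrm{wt}(\mathsf{c}_2)$ for $[\mathsf{c}_1,\mathsf{c}_2]\ne0$. The basic commutators of weight $1$ are the elements of $X$ in some well-order. For $n\ge2$, the basic commutators of weight $n$ are the Lie commutators $[\mathsf{u},\mathsf{v}]$ such that (1) $\mathsf{u},\mathsf{v}$ are basic commutators with $\mathrm{wt}(\mathsf{u})+\mathrm{wt}(\mathsf{v})=n$; (2) $\mathsf{u}>\mathsf{v}$, and if $\mathsf{u}=[\mathsf{y},\mathsf{z}]$ with basic commutators $\mathsf{y},\mathsf{z}$, then $\mathsf{v}\ge\mathsf{z}$. The order is extended so that $\mathsf{u}<\mathsf{v}$ whenever $\mathrm{wt}(\mathsf{u})<\mathrm{wt}(\mathsf{v})$, and arbitrarily among the new basic commutators of weight $n$. *)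

(* Defs.v *)
From HB Require Import structures.
From mathcomp Require Import all_boot all_order all_algebra.
From mathcomp Require Import all_classical all_reals all_analysis.
From mathcomp Require Import wochoice.
From mathcomp.multinomials Require monalg.
(* The notations of monalg clash with those of MathComp-Analysis. *)
Import -(notations) monalg.

Set Implicit Arguments.
Unset Strict Implicit.
Unset Printing Implicit Defensive.

Import Order.TTheory GRing.Theory Num.Theory.
Import numFieldNormedType.Exports.

Local Open Scope classical_set_scope.
Local Open Scope ring_scope.

Section QuotientDimension.
Variables (F : fieldType) (M : lmodType F).
Implicit Types V W : set M.

Definition sum_set V W : set M := [set v + w | v in V & w in W].

(* The classes of b 0, ..., b (k - 1) form a basis of V / W, where W is a
   subspace of the subspace V. *)
Definition quot_basis V W (k : nat) (b : 'I_k -> M) : Prop :=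
  (forall i, V (b i)) /\
  forall v, V v -> exists! c : 'rV[F]_k, W (v - \sum_i c 0 i *: b i).

(* dim (V / W); it is 0 by convention if V / W is infinite dimensional. *)
Definition quot_dim V W : nat :=
  xget 0%N [set k | exists b : 'I_k -> M, quot_basis V W b].

(* The sum of the V m for m > n. *)
Definition sum_gt (V : nat -> set M) (n : nat) : set M :=
  [set u | exists N, exists2 v : nat -> M,
     (forall m, (n < m)%N -> V m (v m)) & u = \sum_(n.+1 <= m < N) v m].

End QuotientDimension.

Section RestrictedLie.
(* Left algebras suffice here, and monalg gives no more than this structure to
   the algebra of a noncommutative monoid. *)
Variables (F : fieldType) (A : lalgType F).

Definition lie (u v : A) : A := u * v - v * u.

Record restricted_lie (p : nat) (S : set A) : Prop := RestrictedLie {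
  restricted_lie0 : S 0;
  restricted_lieD : forall u v, S u -> S v -> S (u + v);
  restricted_lieZ : forall (a : F) u, S u -> S (a *: u);
  restricted_lieL : forall u v, S u -> S v -> S (lie u v);
  restricted_lieX : forall u, S u -> S (u ^+ p) }.

Definition restricted_gen (p : nat) (G : set A) : set A :=
  smallest (restricted_lie p) G.

End RestrictedLie.

Section FreeRestrictedLie.
Variables p d : nat.

Definition free_alg : lalgType 'F_p := malg (fmonom 'I_d) 'F_p.

Definition gen (i : 'I_d) : free_alg := mkmalgU (fmu i) 1.

Definition free_rlie : set free_alg := restricted_gen p (range gen).

Definition word_span (n : nat) : set free_alg :=
  [set u | exists c : n.-tuple 'I_d -> 'F_p,
     u = \sum_t c t *: \prod_(i <- t) gen i].

Definition free_rlie_hom (n : nat) : set free_alg := free_rlie `&` word_span n.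

Definition free_rlie_gt (n : nat) : set free_alg := sum_gt free_rlie_hom n.

(* The sum of the S `&` free_rlie_hom n for n > 0 is direct, because distinct
   words are linearly independent. *)
Definition graded (S : set free_alg) : Prop :=
  S = sum_gt (fun n => S `&` free_rlie_hom n) 0.

Definition rlie_subalg (S : set free_alg) : Prop :=
  restricted_lie p S /\ S `<=` free_rlie.

Definition den (K : realType) (S : set free_alg) : K :=
  limn_inf (fun n =>
    (quot_dim (sum_set S (free_rlie_gt n)) (free_rlie_gt n))%:R
    / (quot_dim free_rlie (free_rlie_gt n))%:R).

Definition dspec (K : realType) : set K := den K @` [set S | rlie_subalg S].

End FreeRestrictedLie.

Arguments dspec : clear implicits.

Section BasicCommutators.
Variable d : nat.

(* Formal bracketings of generators. The factors u and v of a commutator [u, v]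
   are not determined by its value as an element of the algebra; for instance
   [u, v] = [v, u] in characteristic 2. *)
Inductive bracket : Type :=
| Gen of 'I_d
| Bracket of bracket & bracket.

Fixpoint weight (t : bracket) : nat :=
  match t with
  | Gen _ => 1%N
  | Bracket u v => (weight u + weight v)%N
  end.

(* The relation le is the (non-strict) order on basic commutators, so that
   ~~ le u v stands for u > v. *)
Fixpoint basic (le : rel bracket) (t : bracket) : bool :=
  match t with
  | Gen _ => true
  | Bracket u v =>
      [&& basic le u, basic le v, ~~ le u v
        & if u is Bracket _ z then le z v else true]
  end.

(* A choice of the well-order in the inductive definition of the basic
   commutators: only its values on basic commutators matter. *)
Definition basic_order (le : rel bracket) : Prop :=
  wo_chain le (basic le) /\
  forall u v, basic le u -> basic le v -> (weight u < weight v)%N -> ~~ le v u.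

Fixpoint bracket_val (p : nat) (t : bracket) : free_alg p d :=
  match t with
  | Gen i => gen p i
  | Bracket u v => lie (bracket_val p u) (bracket_val p v)
  end.

Definition basic_commutators (p : nat) (le : rel bracket) :
    set (free_alg p d) :=
  bracket_val p @` [set t | basic le t].

End BasicCommutators.

(* Main.v *)
(*
The density of a graded subalgebra compares the dimensions of its components with
those of R.  Let s be one of the generators.  Basic commutators other than s are
adjoined in order of weight, one at a time, each only if the dimension of the
subalgebra S generated so far, in degrees at most the current weight n, is below
alpha dim(R / R_(>n)); each of them raises this dimension by at most one.

- The density does not fall below alpha: in every degree n where all basic
  commutators had to be taken, S contains the degree n part L_n of the free Lie
  algebra, by Hall's collection argument.  Since R = L + R^p, where L is an ideal
  of R with [R, R] <= L and the p-map is additive modulo L (Jacobson), the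
  codimension of L_n in R_n is at most d^(n/p), which is negligible.
- The density does not exceed alpha: otherwise nothing is adjoined from some
  point on, and S is generated by finitely many commutators other than s.  These
  lie in the associative algebra generated by the ad(s)^j x with x <> s and j < N,
  whose degree n part has at most as many dimensions as there are words of length
  n without factor s^N.  This is negligible with respect to dim L_n: every word
  without factor s^K gives, for an order in which s is the largest letter, the
  leading word of a Lie element, and K can be taken much larger than N.
*)
From HB Require Import structures.
Require Import Defs.
From mathcomp Require Import all_boot all_order all_algebra.
From mathcomp Require Import all_classical all_reals all_analysis.
From mathcomp.multinomials Require monalg.
Import -(notations) monalg.
From mathcomp Require Import finfield wochoice zify ring lra.

Set Implicit Arguments.
Unset Strict Implicit.
Unset Printing Implicit Defensive.

Import Order.TTheory GRing.Theory Num.Theory.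

Local Open Scope classical_set_scope.
Local Open Scope ring_scope.

(** * Jacobson's formula *)

Section Jacobson.
Variable R : nzRingType.
Implicit Types x y u v : R.

Definition ad x y := x * y - y * x.

(** Left and right multiplication by x commute, so this is the binomial formula for their
    difference. *)
Lemma iter_adE x u m :
  iter m (ad x) u =
  \sum_(i < m.+1) ((-1) ^+ i *+ 'C(m, i)) * (x ^+ (m - i) * u * x ^+ i).
Proof.
elim: m => [|m IHm]; first by rewrite big_ord1 bin0 !mul1r mulr1.
rewrite iterS IHm /ad mulr_sumr mulr_suml -sumrB.
have step (i : 'I_m.+1) :
    x * ((-1) ^+ i *+ 'C(m, i) * (x ^+ (m - i) * u * x ^+ i))
    - (-1) ^+ i *+ 'C(m, i) * (x ^+ (m - i) * u * x ^+ i) * x =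
    (-1) ^+ i *+ 'C(m, i) * (x ^+ (m.+1 - i) * u * x ^+ i)
    + (-1) ^+ i.+1 *+ 'C(m, i) * (x ^+ (m - i) * u * x ^+ i.+1).
  rewrite subSn ?leq_ord // (exprS x (m - i)) (exprSr x i) (exprS (-1) i).
  rewrite mulN1r mulNrn mulNr; congr (_ - _); last by rewrite !mulrA.
  have cx : GRing.comm x ((-1) ^+ i *+ 'C(m, i)).
    by apply: commrMn; apply: commrX; apply: commrN1.
  by rewrite mulrA cx -!mulrA.
rewrite (eq_bigr _ (fun i _ => step i)) big_split /= {step}.
(* The two sums are shifted against each other by one and recombine by Pascal's rule. *)
rewrite [LHS]addrC [X in _ + X]big_ord_recl [in RHS]big_ord_recl /= !bin0 subn0.
rewrite addrCA; congr (_ + _).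
under [RHS]eq_bigr => i _ do
  rewrite /bump /= add1n subSS binS mulrnDr mulrDl.
rewrite big_split /= addrC; congr (_ + _).
rewrite [RHS]big_ord_recr /= bin_small // mulr0n mul0r addr0.
by apply: eq_bigr => i _; rewrite /bump /= add1n subSS.
Qed.

Variable p : nat.
Hypothesis pchR : p \in [pchar R].

Let p_prime : prime p. Proof. exact: pcharf_prime pchR. Qed.

(** Modulo p only the two extreme terms of the binomial expansion survive. *)
Lemma iter_ad_pchar x u : iter p (ad x) u = ad (x ^+ p) u.
Proof.
rewrite iter_adE; case: p pchR p_prime => [|q] // chq prq.
rewrite big_ord_recl big_ord_recr /= big1 ?add0r => [|i _].
  rewrite bin0 subn0 expr0 mul1r mulr1 /bump /= add1n binn subnn mul1r mulr1n.
  rewrite /ad; congr (_ + _).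
  (* Additivity of Frobenius covers p = 2 as well. *)
  have -> : (-1 : R) ^+ q.+1 = -1.
    by rewrite -(pFrobenius_autE chq) pFrobenius_autN pFrobenius_aut1.
  by rewrite mulN1r.
have : (q.+1 %| 'C(q.+1, bump 0 i))%N.
  by apply: prime_dvd_bin => //=; rewrite /bump /= add1n ltnS ltn_ord.
case/dvdnP=> k ->; rewrite -mulr_natr natrM.
by move: chq => /andP[_ /eqP ->]; rewrite mulr0 mulr0 mul0r.
Qed.

(** Since C(p, i+1) vanishes modulo p, Pascal's rule makes consecutive C(p-1, i) opposite. *)
Lemma sign_bin_pchar i : (i < p)%N -> (-1) ^+ i *+ 'C(p.-1, i) = 1 :> R.
Proof.
have pE : p.-1.+1 = p by rewrite prednK // prime_gt0.
elim: i => [|i IHi] ip; first by rewrite bin0.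
have: (-1) ^+ i.+1 *+ 'C(p, i.+1) = 0 :> R.
  have /dvdnP[k ->] := prime_dvd_bin p_prime (ip : 0 < i.+1 < p)%N.
  by rewrite -mulr_natr natrM; move: pchR => /andP[_ /eqP ->]; rewrite !mulr0.
rewrite -[in 'C(p, _)]pE binS mulrnDr.
move/eqP; rewrite addr_eq0 => /eqP ->.
by rewrite exprS mulN1r mulNrn opprK IHi // ltnW.
Qed.

(** With all coefficients equal to 1, the iterated commutator takes the shape of the noncommutative
    derivative of a p-th power in [deriv_exp_noncomm]. *)
Lemma iter_ad_pred_pchar x u :
  iter p.-1 (ad x) u = \sum_(i < p) x ^+ (p.-1 - i) * u * x ^+ i.
Proof.
rewrite iter_adE prednK ?prime_gt0 //; apply: eq_bigr => i _.
by rewrite sign_bin_pchar ?mul1r.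
Qed.

End Jacobson.

Lemma deriv_exp_noncomm (R : nzRingType) (f : {poly R}) n :
  (f ^+ n)^`() = \sum_(i < n) f ^+ (n.-1 - i) * f^`() * f ^+ i.
Proof.
elim: n => [|n IHn]; first by rewrite expr0 derivC big_ord0.
rewrite exprSr derivM IHn mulr_suml big_ord_recl /= subn0 expr0 mulr1 addrC.
congr (_ + _); apply: eq_bigr => i _.
by rewrite /bump /= add1n exprSr mulrA subnS -!subn1 subnAC.
Qed.

(* Jacobson's formula, obtained by integrating the derivative of (u T + v)^p,
   which is ad(u T + v)^(p-1) u because p is the characteristic. *)
Lemma jacobson (R : nzRingType) (p : nat) (M : R -> Prop) (u v : R) :
  p \in [pchar R] -> M 0 -> (forall x y, M x -> M y -> M (x - y)) ->
  M (ad v u) ->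
  (forall x, M x -> M (ad u x)) -> (forall x, M x -> M (ad v x)) ->
  M ((u + v) ^+ p - u ^+ p - v ^+ p).
Proof.
move=> chR M0 MB Mvu Mu Mv.
have pr := pcharf_prime chR.
have MN x : M x -> M (- x) by move=> Mx; rewrite -sub0r; apply: MB.
have MD x y : M x -> M y -> M (x + y).
  by move=> Mx My; rewrite -[y]opprK; apply: MB => //; apply: MN.
have MMn x n : M x -> M (x *+ n).
  by move=> Mx; elim: n => [|n IHn]; rewrite ?mulr0n // mulrS; apply: MD.
pose X : {poly R} := u%:P * 'X + v%:P.
have coefX n : X`_n = u * (n == 1)%:R + v *+ (n == 0).
  rewrite /X coefD coefMX coefC.
  by case: n => [|[|n]] /=; rewrite ?coefC ?mulr0 ?mulr1 ?mulr1n ?mulr0n //= mulr0n.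
pose adX := ad X.
have coef_ad (f : {poly R}) n :
    (adX f)`_n = (if n is n'.+1 then ad u f`_n' else 0) + ad v f`_n.
  have -> : adX f = u%:P * (f * 'X) + v%:P * f - (f * u%:P * 'X + f * v%:P).
    by rewrite /adX /ad /X mulrDl mulrDr (commr_polyX f) !mulrA.
  rewrite coefB !coefD !coefCM !coefMX !coefMC.
  case: n => [|n] /=; first by rewrite mulr0 !add0r.
  by rewrite /ad opprD addrACA.
(* The induction starts inside M because ad(X) u is the constant ad(v) u, as ad(u) u = 0. *)
have adM k n : M (iter k.+1 adX u%:P)`_n.
  elim: k n => [|k IHk] n.
    rewrite /= coef_ad coefC; case: n => [|n]; first by rewrite add0r.
    rewrite /= coefC; case: n => [|n] /=.
      by rewrite /ad subrr mulr0 mul0r subrr addr0.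
    by rewrite /ad !(mulr0, mul0r) !subrr addr0.
  rewrite iterS coef_ad; case: n => [|n]; first by rewrite add0r; apply: Mv.
  by apply: MD; [apply: Mu | apply: Mv].
have dX : (X ^+ p)^`() = iter p.-1 adX u%:P.
  rewrite (@iter_ad_pred_pchar _ p) ?pchar_poly //.
  rewrite deriv_exp_noncomm; apply: eq_bigr => i _.
  by rewrite /X derivD derivC addr0 derivM derivC mul0r add0r derivX mulr1.
have szX : (size X <= 2)%N.
  by apply/leq_sizeP => -[|[|j]] // _; rewrite coefX /= mulr0 mulr0n addr0.
have szXn n : (size (X ^+ n) <= n.+1)%N.
  elim: n => [|n IHn]; first by rewrite expr0 size_poly1.
  rewrite exprS (leq_trans (size_polyMleq _ _)) // -subn1 leq_subLR.
  exact: (leq_add szX IHn).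
have topX n : (X ^+ n)`_n = u ^+ n.
  elim: n => [|n IHn]; first by rewrite !expr0 coef1.
  rewrite exprS /X mulrDl coefD -mulrA -commr_polyX mulrA coefMX coefCM -/X.
  by rewrite coefCM IHn -exprS [X in v * X]nth_default ?mulr0 ?addr0 // szXn.
have botX n : (X ^+ n)`_0 = v ^+ n.
  elim: n => [|n IHn]; first by rewrite !expr0 coef1.
  by rewrite exprS coef0M IHn coefX /= mulr0 add0r exprS.
have hX n : (X ^+ n).[1] = (u + v) ^+ n.
  have X1 : X.[1] = u + v by rewrite /X hornerD hornerMX !hornerC mulr1.
  elim: n => [|n IHn]; first by rewrite !expr0 hornerC.
  rewrite exprSr hornerM_comm ?IHn ?X1 ?exprSr //.
  by rewrite /comm_poly mulr1 mul1r.
have midX i : (0 < i < p)%N -> M (X ^+ p)`_i.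
  case: i => // i /= ip.
  have p1 : p.-1 = p.-2.+1.
    by case: (p) ip (prime_gt1 pr) => [|[]].
  have := adM p.-2 i; rewrite -p1 -dX coef_deriv => Mi.
  (* The derivative yields only i + 1 times the coefficient; i + 1 is invertible modulo p, with
     inverse a from Bezout's identity. *)
  have cop : coprime i.+1 p by rewrite coprime_sym prime_coprime // gtnNdvd.
  have [a b ab _] := egcdnP p (ltn0Sn i).
  have -> : (X ^+ p)`_i.+1 = ((X ^+ p)`_i.+1 *+ i.+1) *+ a.
    rewrite -mulrnA mulnC ab (eqP cop) mulrnDr mulrnA mulrnAC.
    rewrite -[_ *+ p]mulr_natr; move: chR => /andP[_ /eqP ->].
    by rewrite mulr0 mul0rn add0r.
  exact: MMn.
(* At T = 1 the power is the sum of its coefficients; the top one is u^p and the constant one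
   v^p. *)
rewrite -hX (horner_coef_wide _ (szXn p)).
under eq_bigr => i _ do rewrite expr1n mulr1.
have pE : p = p.-1.+1 by rewrite prednK // prime_gt0.
rewrite big_ord_recr /= topX addrK -(big_mkord predT (fun i => (X ^+ p)`_i)).
rewrite big_ltn ?prime_gt0 // botX addrAC subrr add0r big_nat_cond.
by apply: (big_ind M) => // i; rewrite andbT; apply: midX.
Qed.

(** * Words and coefficients *)

(* The free associative algebra, known only through the coefficients of its
   elements and not through a construction. *)
Record word_algebra (p d : nat) := WordAlgebra {
  word_lalg :> lalgType 'F_p;
  letter : 'I_d -> word_lalg;
  wcoef : seq 'I_d -> {linear word_lalg -> 'F_p | *%R};
  wcoefP : forall u v, (forall w, wcoef w u = wcoef w v) -> u = v;
  wcoef1 : forall w, wcoef w 1 = (w == [::])%:R;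
  wcoef_letter : forall w i, wcoef w (letter i) = (w == [:: i])%:R;
  wcoefM : forall w u v, wcoef w (u * v) =
    \sum_(i < (size w).+1) wcoef (take i w) u * wcoef (drop i w) v;
  wcoef_finite : forall u, exists N, forall w, (N <= size w)%N -> wcoef w u = 0 }.

Arguments wcoef {p d w} _ : rename.
Arguments wcoefP {p d w} _ _ _ : rename.
Arguments wcoef1 {p d w} _ : rename.
Arguments wcoef_letter {p d w} _ _ : rename.
Arguments wcoefM {p d w} _ _ _ : rename.
Arguments wcoef_finite {p d w} _ : rename.

Section Words.
Variables (p d : nat) (A : word_algebra p d).
Local Notation word := (seq 'I_d).
Implicit Types (u v : A) (w : word).

Lemma wcoefZ w a u : wcoef w (a *: u) = a * wcoef w u.
Proof. exact: linearZ. Qed.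

(* Not an axiom of left algebras: it is read off from the coefficients. *)
Lemma scale_mulr (a : 'F_p) u v : u * (a *: v) = a *: (u * v).
Proof.
apply: wcoefP => w; rewrite wcoefZ !wcoefM mulr_sumr.
by apply: eq_bigr => i _; rewrite wcoefZ mulrCA.
Qed.

Definition homog n u := forall w, size w != n -> wcoef w u = 0.

Lemma homog_letter i : homog 1 (letter A i).
Proof. by move=> w; rewrite wcoef_letter; have [->|] := eqVneq w [:: i]. Qed.

(** Of all ways to cut the word, only the cut after m letters can meet a nonzero coefficient of
    u. *)
Lemma wcoefM_homog m w w' u v : homog m u -> size w = m ->
  wcoef (w ++ w') (u * v) = wcoef w u * wcoef w' v.
Proof.
move=> hu wm; rewrite wcoefM.
have wl : (m < (size (w ++ w')).+1)%N by rewrite size_cat wm ltnS leq_addr.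
rewrite (bigD1 (Ordinal wl)) //= take_size_cat // drop_size_cat //.
rewrite big1 ?addr0 // => i ni; rewrite hu ?mul0r //.
by rewrite size_takel // -ltnS ltn_ord.
Qed.

Definition monom w : A := \prod_(i <- w) letter A i.

Lemma wcoef_monom w w' : wcoef w (monom w') = (w == w')%:R.
Proof.
elim: w' w => [|i w' IH] w; first by rewrite /monom big_nil wcoef1.
rewrite /monom big_cons -/(monom w') wcoefM.
case: w => [|j w].
  by rewrite big_ord1 /= wcoef_letter mul0r.
rewrite -wcoefM -[j :: w]/([:: j] ++ w) (wcoefM_homog _ _ (@homog_letter i)) //.
by rewrite wcoef_letter IH /= !eqseq_cons andbT -natrM mulnb.
Qed.

Definition hcomp n u : A := \sum_(t : n.-tuple 'I_d) wcoef t u *: monom t.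

Lemma wcoef_comp w n u : wcoef w (hcomp n u) = wcoef w u *+ (size w == n).
Proof.
rewrite /hcomp raddf_sum /=; case: eqP => [wn|nw].
  have tP : size w == n by apply/eqP.
  rewrite (bigD1 (Tuple tP)) //= wcoefZ wcoef_monom eqxx mulr1 big1 ?addr0 //.
  move=> t nt; rewrite wcoefZ wcoef_monom; case: eqP => [wt|]; last by rewrite mulr0.
  by case/eqP: nt; apply/val_inj.
rewrite big1 // => t _; rewrite wcoefZ wcoef_monom; case: eqP => [wt|]; last by rewrite mulr0.
by case: nw; rewrite wt size_tuple.
Qed.

Fact comp_is_linear n : linear (hcomp n).
Proof.
move=> a u v; apply: wcoefP => w.
by rewrite wcoef_comp !raddfD /= !wcoefZ !wcoef_comp mulrnDl mulrnAr.
Qed.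

HB.instance Definition _ n :=
  GRing.isLinear.Build 'F_p A A *:%R (hcomp n) (comp_is_linear n).

Lemma homog_comp n u : homog n (hcomp n u).
Proof. by move=> w /negPf nw; rewrite wcoef_comp nw mulr0n. Qed.

Lemma comp_homog n u : homog n u -> hcomp n u = u.
Proof.
move=> hu; apply: wcoefP => w; rewrite wcoef_comp.
by have [_|/hu ->] := eqVneq (size w) n.
Qed.

Lemma comp_homog_neq m n u : homog n u -> m != n -> hcomp m u = 0.
Proof.
move=> hu mn; apply: wcoefP => w; rewrite wcoef_comp raddf0.
by have [wm|//] := eqVneq (size w) m; rewrite hu // wm.
Qed.

Lemma sum_comp u : exists N, forall M, (N <= M)%N -> u = \sum_(0 <= n < M) hcomp n u.
Proof.
have [N uN] := wcoef_finite u; exists N => M NM; apply: wcoefP => w.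
rewrite raddf_sum /=; under eq_bigr => n _ do rewrite wcoef_comp.
have [wN|Nw] := ltnP (size w) M.
  rewrite (bigD1_seq (size w)) ?mem_index_iota ?iota_uniq //= eqxx big1 ?addr0 //.
  by move=> n /negPf nw; rewrite eq_sym nw.
rewrite uN ?(leq_trans NM) // big1 // => n _; exact: mul0rn.
Qed.

Lemma homogM m n u v : homog m u -> homog n v -> homog (m + n)%N (u * v).
Proof.
move=> hu hv w wmn; rewrite wcoefM big1 // => i _.
have iw : (i <= size w)%N by rewrite -ltnS ltn_ord.
have [e1|n1] := eqVneq (size (take i w)) m; last by rewrite hu // mul0r.
have [e2|n2] := eqVneq (size (drop i w)) n; last by rewrite hv // mulr0.
by move: wmn; rewrite -e1 -e2 -size_cat cat_take_drop eqxx.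
Qed.

Lemma homog_lie m n u v : homog m u -> homog n v -> homog (m + n)%N (lie u v).
Proof.
move=> hu hv w wmn; rewrite raddfB /= (homogM hu hv) // (homogM hv hu) ?subr0 //.
by rewrite addnC.
Qed.

Lemma homog1 : homog 0 1.
Proof. by move=> w; rewrite wcoef1 size_eq0 => /negPf ->. Qed.

Lemma homogX m k u : homog m u -> homog (m * k)%N (u ^+ k).
Proof.
move=> hu; elim: k => [|k IHk]; first by rewrite muln0; apply: homog1.
by rewrite exprS mulnS; apply: homogM.
Qed.

(** The filtration by powers of the augmentation ideal. It is multiplicative, and it describes
    R_(>n) inside R without decomposing elements. *)
Definition ord_ge n u := forall w, (size w < n)%N -> wcoef w u = 0.

Lemma ord_geM m n u v : ord_ge m u -> ord_ge n v -> ord_ge (m + n)%N (u * v).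
Proof.
move=> hu hv w wmn; rewrite wcoefM big1 // => i _.
have iw : (i <= size w)%N by rewrite -ltnS ltn_ord.
have [e1|n1] := ltnP (size (take i w)) m; first by rewrite hu // mul0r.
have [e2|n2] := ltnP (size (drop i w)) n; first by rewrite hv // mulr0.
by move: wmn; rewrite -{1}(cat_take_drop i w) size_cat ltnNge leq_add.
Qed.

Lemma homog_ord_ge n u : homog n u -> ord_ge n u.
Proof. by move=> hu w wn; rewrite hu // ltn_eqF. Qed.

Lemma ord_geW m n u : (m <= n)%N -> ord_ge n u -> ord_ge m u.
Proof. by move=> mn hu w wm; rewrite hu // (leq_trans wm). Qed.

End Words.

(** * Restricted Lie algebras *)

Section Submodule.
Variables (F : fieldType) (M : lmodType F).

Definition submodule (V : set M) :=
  V 0 /\ forall (a : F) u v, V u -> V v -> V (a *: u + v).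

Variable V : set M.
Hypothesis V_sub : submodule V.

Lemma submodule0 : V 0. Proof. by case: V_sub. Qed.

Lemma submoduleZ (a : F) u : V u -> V (a *: u).
Proof. by case: V_sub => V0 Vl Vu; rewrite -[_ *: _]addr0; apply: Vl. Qed.

Lemma submoduleD u v : V u -> V v -> V (u + v).
Proof. by case: V_sub => V0 Vl Vu Vv; rewrite -[u]scale1r; apply: Vl. Qed.

Lemma submoduleN u : V u -> V (- u).
Proof. by rewrite -scaleN1r; apply: submoduleZ. Qed.

Lemma submoduleB u v : V u -> V v -> V (u - v).
Proof. by move=> Vu Vv; apply/submoduleD/submoduleN. Qed.

Lemma submodule_sum (I : Type) (r : seq I) (P : pred I) (f : I -> M) :
  (forall i, P i -> V (f i)) -> V (\sum_(i <- r | P i) f i).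
Proof. by move=> Vf; apply: big_ind => //; [apply: submodule0|apply: submoduleD]. Qed.

End Submodule.

Section RestrictedGen.
Variables (F : fieldType) (A : lalgType F) (p : nat).
Implicit Types (B S : set A) (u v : A).

Lemma restricted_lie_submodule S : restricted_lie p S -> submodule S.
Proof. by case=> S0 SD SZ _ _; split=> // a u v Su Sv; apply/SD/Sv/SZ. Qed.

Lemma restricted_gen_lie B : restricted_lie p (restricted_gen p B).
Proof.
split.
- by move=> S [[S0 _ _ _ _] _].
- by move=> u v gu gv S SB; case: (SB) => -[_ SD _ _ _] _; apply: SD; [apply: gu|apply: gv].
- by move=> a u gu S SB; case: (SB) => -[_ _ SZ _ _] _; apply: SZ; apply: gu.
- by move=> u v gu gv S SB; case: (SB) => -[_ _ _ SL _] _; apply: SL; [apply: gu|apply: gv].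
- by move=> u gu S SB; case: (SB) => -[_ _ _ _ SX] _; apply: SX; apply: gu.
Qed.

Lemma sub_restricted_gen B : B `<=` restricted_gen p B.
Proof. exact: sub_gen_smallest. Qed.

Lemma restricted_gen_min B S : restricted_lie p S -> B `<=` S ->
  restricted_gen p B `<=` S.
Proof. exact: smallest_sub. Qed.

Lemma restricted_gen_submodule B : submodule (restricted_gen p B).
Proof. exact/restricted_lie_submodule/restricted_gen_lie. Qed.

Lemma restricted_genS B B' : B `<=` B' -> restricted_gen p B `<=` restricted_gen p B'.
Proof.
move=> BB'; apply: restricted_gen_min; first exact: restricted_gen_lie.
by move=> b /BB'; apply: sub_restricted_gen.
Qed.

End RestrictedGen.

Section Lie.
Variables (F : fieldType) (A : lalgType F).
Implicit Types (u v w : A).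

Lemma lieC u v : lie u v = - lie v u.
Proof. by rewrite /lie opprB. Qed.

Lemma lie_self u : lie u u = 0.
Proof. by rewrite /lie subrr. Qed.

Lemma lieDl u v w : lie (u + v) w = lie u w + lie v w.
Proof. by rewrite /lie mulrDl mulrDr opprD addrACA. Qed.

Lemma lieDr u v w : lie u (v + w) = lie u v + lie u w.
Proof. by rewrite lieC lieDl opprD -!lieC. Qed.

Lemma lieBr u v w : lie u (v - w) = lie u v - lie u w.
Proof. by rewrite lieDr; congr (_ + _); rewrite /lie mulrN mulNr opprK opprB addrC. Qed.

Lemma lieBl u v w : lie (u - v) w = lie u w - lie v w.
Proof. by rewrite lieC lieBr opprB [lie u w]lieC [lie v w]lieC opprK addrC. Qed.

Lemma lie0 u : lie u 0 = 0.
Proof. by rewrite /lie mulr0 mul0r subrr. Qed.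

Lemma lie0l u : lie 0 u = 0.
Proof. by rewrite lieC lie0 oppr0. Qed.

Lemma jacobi u v w : lie (lie u v) w = lie u (lie v w) - lie v (lie u w).
Proof.
rewrite /lie !mulrBr !mulrBl !mulrA !opprB !addrA.
by rewrite [RHS](ACl (1*8*3*6*(5*2)*(7*4))) /= !subrr !addr0.
Qed.

End Lie.

(** * Graded subalgebras *)

Section Graded.
Variables (p d : nat) (p_prime : prime p) (A : word_algebra p d).
Implicit Types (u v : A) (S B V : set A).

Lemma pchar_word_algebra : p \in [pchar A].
Proof.
apply/andP; split=> //; rewrite -[X in X == _](scaler_nat p (1 : A)).
by have /andP[_ /eqP ->] := pchar_Fp p_prime; rewrite scale0r.
Qed.

Lemma FermatZ (a : 'F_p) u : (a *: u) ^+ p = a *: u ^+ p.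
Proof.
have sX n : (a *: u) ^+ n = a ^+ n *: u ^+ n.
  elim: n => [|n IHn]; first by rewrite !expr0 scale1r.
  by rewrite !exprS IHn -scalerAl scale_mulr scalerA.
by rewrite sX -{2}(expf_card a) card_Fp.
Qed.

Lemma jacobson_lie V u v : submodule V -> V (lie v u) ->
  (forall x, V x -> V (lie u x)) -> (forall x, V x -> V (lie v x)) ->
  V ((u + v) ^+ p - u ^+ p - v ^+ p).
Proof.
move=> Vs Vvu Vu Vv; apply: (jacobson (M := V)) => //.
- exact: pchar_word_algebra.
- exact: (submodule0 Vs).
- by move=> x y; apply: (submoduleB Vs).
Qed.

Lemma lie_pX u v : lie (u ^+ p) v = iter p (lie u) v.
Proof. exact/esym/(iter_ad_pchar pchar_word_algebra). Qed.

Lemma comp_homog_eq n m u : homog m u -> hcomp n u = u *+ (n == m).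
Proof.
move=> hu; have [->|nm] := eqVneq n m; first by rewrite comp_homog.
by rewrite (comp_homog_neq hu).
Qed.

Lemma compM n u v :
  hcomp n (u * v) = \sum_(i < n.+1) hcomp i u * hcomp (n - i)%N v.
Proof.
apply: wcoefP => w; rewrite wcoef_comp raddf_sum /=.
case: eqVneq => [wn|nw]; last first.
  rewrite big1 // => i _.
  have iu : homog (i + (n - i)%N)%N (hcomp i u * hcomp (n - i)%N v).
    by apply: homogM; apply: homog_comp.
  by rewrite iu // subnKC // -ltnS ltn_ord.
rewrite mulr1n wcoefM -wn; apply: eq_bigr => i _.
have iw : (i <= size w)%N by rewrite -ltnS ltn_ord.
rewrite -[w in wcoef w (_ * _)](cat_take_drop i w).
rewrite (wcoefM_homog _ _ (@homog_comp _ _ _ i u)) ?size_takel //.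
by rewrite !wcoef_comp size_takel // size_drop !eqxx.
Qed.

Lemma comp_lie n u v :
  hcomp n (lie u v) = \sum_(i < n.+1) lie (hcomp i u) (hcomp (n - i)%N v).
Proof.
rewrite raddfB /= !compM sumrB; congr (_ - _).
rewrite (reindex_inj rev_ord_inj) /=; apply: eq_bigr => i _.
by rewrite subSS subKn // -ltnS ltn_ord.
Qed.

Lemma submodule_ord_ge n : submodule [set u : A | ord_ge n u].
Proof.
split=> [w _|a u v hu hv w wn]; first by rewrite raddf0.
by rewrite raddfD /= wcoefZ hu // hv // mulr0 addr0.
Qed.

Lemma ord_ge_exp n k u : ord_ge n u -> (0 < k)%N -> ord_ge (n * k)%N (u ^+ k).
Proof.
move=> hu; elim: k => // -[|k] IH _; first by rewrite muln1.
by rewrite exprS mulnS; apply: ord_geM => //; apply: IH.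
Qed.

Lemma ord_ge_lie m n u v : ord_ge m u -> ord_ge n v -> ord_ge (m + n)%N (lie u v).
Proof.
move=> hu hv; apply: (submoduleB (submodule_ord_ge (m + n)%N)) => /=; first exact: ord_geM.
by rewrite addnC; apply: ord_geM.
Qed.

Lemma restricted_lie_ord_ge n : restricted_lie p [set u : A | ord_ge n.+1 u].
Proof.
have sub := submodule_ord_ge n.+1; split => /=.
- exact: submodule0.
- exact: submoduleD.
- by move=> a u; apply: submoduleZ.
- move=> u v hu hv; apply: (@ord_geW _ _ _ _ (n.+1 + n.+1)%N); first exact: leq_addl.
  exact: ord_ge_lie.
- move=> u hu; apply: (@ord_geW _ _ _ _ (n.+1 * p)%N); first by rewrite leq_pmulr // prime_gt0.
  by apply: ord_ge_exp => //; exact: prime_gt0.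
Qed.

(** For a subspace of R this amounts to being graded. *)
Definition comp_closed V := forall u n, V u -> V (hcomp n u).

(** The elements of G all of whose components lie in G form a restricted Lie algebra T. Only the
    p-map is not immediate: by Jacobson's formula, the p-th power of a sum of components differs
    from the sum of their p-th powers by an element of T. *)
Lemma restricted_gen_comp B :
  (forall u, B u -> exists n, homog n u) -> comp_closed (restricted_gen p B).
Proof.
move=> Bh u n gu; move: gu n; set G := restricted_gen p B.
have GL : restricted_lie p G := restricted_gen_lie p B.
have Gsub : submodule G := restricted_gen_submodule p B.
pose T := [set u | G u /\ forall n, G (hcomp n u)].
suff TL : restricted_lie p T.
  suff GT : G `<=` T by move=> gu n; apply: (GT _ gu).2.
  apply: restricted_gen_min => // u' Bu; split; first exact: sub_restricted_gen.
  have [m hm] := Bh _ Bu => n; rewrite (comp_homog_eq _ hm); case: (n == m).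
    exact: sub_restricted_gen.
  exact: (submodule0 Gsub).
have Tsub : submodule T.
  split; first by split=> [|n]; rewrite ?raddf0; exact: (submodule0 Gsub).
  move=> a u' v [Gu Gnu] [Gv Gnv]; split.
    by apply: (submoduleD Gsub) => //; apply: (submoduleZ Gsub).
  move=> n; rewrite linearP; apply: (submoduleD Gsub); last exact: Gnv.
  by apply: (submoduleZ Gsub); apply: Gnu.
have Tlie u' v : T u' -> T v -> T (lie u' v).
  case: GL => _ _ _ GL _ [Gu Gnu] [Gv Gnv]; split; first exact: GL.
  by move=> n; rewrite comp_lie; apply: (submodule_sum Gsub) => i _; apply: GL.
split=> //.
- exact: (submodule0 Tsub).
- exact: (submoduleD Tsub).
- by move=> a v; apply: (submoduleZ Tsub).
move=> v Tv; have [N /(_ N (leqnn N)) vN] := sum_comp v.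
have Thom m : T (hcomp m v).
  split=> [|n]; first exact: Tv.2.
  rewrite (comp_homog_eq _ (@homog_comp _ _ _ m v)); case: (n == m); first exact: Tv.2.
  exact: (submodule0 Gsub).
rewrite vN; elim: N {vN} => [|N IHN].
  by rewrite big_geq // expr0n gtn_eqF ?prime_gt0 //; exact: (submodule0 Tsub).
rewrite big_nat_recr //=; set s := \sum_(_ <= _ < _) _ in IHN *; set c := hcomp N v.
have Ts : T s by apply: (submodule_sum Tsub) => i _.
have Tc : T c by exact: Thom.
have Tcp : T (c ^+ p).
  have Gcp : G (c ^+ p) by case: GL => _ _ _ _; apply; case: Tc.
  have hcp : homog (N * p)%N (c ^+ p) by apply: homogX; exact: homog_comp.
  split=> // n; rewrite (comp_homog_eq _ hcp).
  by case: (n == _) => //; exact: (submodule0 Gsub).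
rewrite -[X in T X](subrK (c ^+ p)) -[X in T (X + _)](subrK (s ^+ p)) addrAC.
apply: (submoduleD Tsub) => //; apply: (submoduleD Tsub) => //.
rewrite addrAC; apply: jacobson_lie => //; first exact: Tlie.
- by move=> x; apply: Tlie.
- by move=> x; apply: Tlie.
Qed.

End Graded.

(** * Dimensions of linear images *)

Section ImageDimension.
Variables (F : finFieldType) (M : lmodType F).
Implicit Types (V W : set M) (k : nat).

(** Over a finite field the rows can be enumerated, which turns an image given as a set into a
    [vspace]. *)
Definition vimage k (f : {linear M -> 'rV[F]_k}) V : {vspace 'rV[F]_k} :=
  <<[seq x <- enum 'rV[F]_k | `[< (f @` V) x >]]>>%VS.

Definition fdim k (f : {linear M -> 'rV[F]_k}) V := \dim (vimage f V).

Lemma mem_vimage k (f : {linear M -> 'rV[F]_k}) V u : V u -> f u \in vimage f V.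
Proof.
move=> Vu; apply: memv_span; rewrite mem_filter mem_enum.
by rewrite andbT; apply/asboolP; exists u.
Qed.

Lemma vimage_min k (f : {linear M -> 'rV[F]_k}) V (U : {vspace 'rV[F]_k}) :
  (forall u, V u -> f u \in U) -> (vimage f V <= U)%VS.
Proof.
move=> VU; apply/span_subvP => x; rewrite mem_filter => /andP[/asboolP[u Vu <-] _].
exact: VU.
Qed.

Lemma vimageP k (f : {linear M -> 'rV[F]_k}) V x : submodule V ->
  x \in vimage f V -> exists2 u, V u & f u = x.
Proof.
move=> Vs; pose s := [seq x <- enum 'rV[F]_k | `[< (f @` V) x >]].
rewrite -[vimage f V]/(<<in_tuple s>>%VS) => /coord_span ->.
suff : (f @` V) (\sum_(i < size s) coord (in_tuple s) i x *: (in_tuple s)`_i).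
  by case=> u Vu <-; exists u.
apply: (big_ind (f @` V)) => [|_ _ [u Vu <-] [v Vv <-]|i _].
- by exists 0; [exact: (submodule0 Vs)|rewrite linear0].
- by exists (u + v); [exact: (submoduleD Vs)|rewrite linearD].
- have : (in_tuple s)`_i \in s by apply: mem_nth.
  rewrite mem_filter => /andP[/asboolP[u Vu <-] _].
  by exists (coord (in_tuple s) i x *: u); [exact: (submoduleZ Vs)|rewrite linearZ].
Qed.

Lemma fdimS k (f : {linear M -> 'rV[F]_k}) V W : V `<=` W -> (fdim f V <= fdim f W)%N.
Proof.
by move=> VW; apply/dimvS/vimage_min => u /VW; apply: mem_vimage.
Qed.

Lemma fdim_le k (f : {linear M -> 'rV[F]_k}) V : (fdim f V <= k)%N.
Proof.
apply: leq_trans (dimvS (subvf _)) _.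
by rewrite dimvf dim_matrix mul1r.
Qed.

Lemma fdim_le_span k (f : {linear M -> 'rV[F]_k}) V W (s : seq M) :
  (forall u, V u -> exists2 v, W v & f u - f v \in <<map f s>>%VS) ->
  (fdim f V <= fdim f W + size s)%N.
Proof.
move=> VW; rewrite -(size_map f s).
apply: leq_trans (leq_add (leqnn _) (dim_span (map f s))).
apply: leq_trans (dimv_add_leqif _ _).
apply/dimvS/vimage_min => u /VW[v Wv uv].
by rewrite -[f u](subrK (f v)) addrC memv_add // mem_vimage.
Qed.

(** On V the map f has kernel W, so bases of V / W and of f(V) correspond. Hence the set in
    [quot_dim] is a singleton and the default value does not occur. *)
Lemma quot_dimE k (f : {linear M -> 'rV[F]_k}) V W :
  submodule V -> (forall v, V v -> W v <-> f v = 0) ->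
  quot_dim V W = fdim f V.
Proof.
move=> Vs WE.
have fsub m (b : 'I_m -> M) v (c : 'rV[F]_m) : V v -> (forall i, V (b i)) ->
    W (v - \sum_i c 0 i *: b i) <-> f v = \sum_i c 0 i *: f (b i).
  move=> Vv Vb; have Vsum : V (\sum_i c 0 i *: b i).
    by apply: (submodule_sum Vs) => i _; apply: (submoduleZ Vs).
  rewrite WE; last exact: (submoduleB Vs).
  rewrite linearB linear_sum; under eq_bigr do rewrite linearZ.
  by split=> [/eqP|->]; rewrite ?subrr // subr_eq0 => /eqP.
apply: xget_unique.
  pose B := vbasis (vimage f V).
  have Bb : basis_of (vimage f V) B := vbasisP _.
  have /choice[b bP] : forall i : 'I_(fdim f V), exists u, V u /\ f u = B`_i.
    move=> i; have [|u Vu fu] := @vimageP _ f V (B`_i) Vs; last by exists u.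
    by apply: (basis_mem Bb); rewrite mem_nth // size_tuple.
  exists b; split=> [i|v Vv]; first by case: (bP i).
  have Vb i : V (b i) by case: (bP i).
  exists (\row_i coord B i (f v)); split.
    apply/(fsub _ b) => //; under eq_bigr => i _ do rewrite mxE (bP i).2.
    exact: coord_basis Bb (mem_vimage f Vv).
  move=> c /(fsub _ b)-/(_ Vv Vb) fv; apply/rowP => i; rewrite mxE fv.
  under eq_bigr => j _ do rewrite (bP j).2.
  rewrite linear_sum (bigD1 i) //= linearZ /= coord_free ?(basis_free Bb) //.
  rewrite eqxx mulr1 big1 ?addr0 // => j /negPf ji.
  by rewrite linearZ /= coord_free ?(basis_free Bb) // ji mulr0.
(* Conversely, a basis of the quotient maps to a basis of f(V): freeness is the uniqueness of the
   coordinates of 0. *)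
move=> m [b [Vb bP]].
pose X := [tuple f (b i) | i < m].
have XE (i : 'I_m) : X`_i = f (b i) by rewrite -tnth_nth tnth_mktuple.
suff: basis_of (vimage f V) X by move/size_basis => <-.
rewrite basisEfree; apply/and3P; split.
- apply/freeP => c; under eq_bigr do rewrite XE; move=> c0.
  have [c1 [c1P c1U]] := bP 0 (submodule0 Vs).
  have c1E : c1 = 0.
    apply: c1U; apply/(fsub _ b) => //; first exact: (submodule0 Vs).
    by rewrite linear0 big1 // => i _; rewrite mxE scale0r.
  have : c1 = \row_i c i.
    apply: c1U; apply/(fsub _ b) => //; first exact: (submodule0 Vs).
    by rewrite linear0 -[LHS]c0; apply: eq_bigr => i _; rewrite mxE.
  by rewrite c1E => /rowP + i => /(_ i); rewrite !mxE.
- apply/span_subvP => _ /tnthP[i ->]; rewrite tnth_mktuple.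
  exact: mem_vimage.
- have sX : (vimage f V <= <<X>>)%VS.
    apply: vimage_min => u Vu; have [c [/(fsub _ b)-/(_ Vu Vb) -> _]] := bP u Vu.
    apply: memv_suml => i _; apply: memvZ; rewrite -XE memv_span //.
    by apply: mem_nth; rewrite size_tuple.
  by apply: leq_trans (dimvS sX) (dim_span X).
Qed.

Lemma fdim_sub k (f : {linear M -> 'rV[F]_k}) V W :
  (forall u, V u -> exists2 v, W v & f u = f v) ->
  (fdim f V <= fdim f W)%N.
Proof.
move=> VW; apply/dimvS/vimage_min => u /VW[v Wv ->]; exact: mem_vimage.
Qed.

Lemma fdim_free k (f : {linear M -> 'rV[F]_k}) V n (b : 'I_n -> M) :
  (forall i, V (b i)) ->
  (forall c : 'I_n -> F, f (\sum_i c i *: b i) = 0 -> forall i, c i = 0) ->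
  (n <= fdim f V)%N.
Proof.
move=> Vb bfree; pose X := [tuple f (b i) | i < n].
have XE (i : 'I_n) : X`_i = f (b i) by rewrite -tnth_nth tnth_mktuple.
have /eqnP : free X.
  apply/freeP => c; under eq_bigr do rewrite XE -linearZ.
  by rewrite -linear_sum; apply: bfree.
rewrite size_tuple => <-; apply/dimvS/span_subvP => _ /tnthP[i ->].
by rewrite tnth_mktuple mem_vimage.
Qed.

(** Rank and nullity for the left projection of h(V): its image is f(V), and its kernel is a copy of
    g(V) because every value of g on V is attained where f vanishes. *)
Lemma fdim_row_mx k l (f : {linear M -> 'rV[F]_k}) (g : {linear M -> 'rV[F]_l})
    (h : {linear M -> 'rV[F]_(k + l)}) V :
  submodule V -> (forall u, h u = row_mx (f u) (g u)) ->
  (forall u, V u -> exists2 v, V v & f v = 0 /\ g v = g u) ->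
  fdim h V = (fdim f V + fdim g V)%N.
Proof.
move=> Vs hE Vg.
pose lf : 'Hom('rV[F]_(k + l), 'rV[F]_k) := linfun lsubmx.
pose rf : 'Hom('rV[F]_(k + l), 'rV[F]_l) := linfun rsubmx.
rewrite /fdim -(limg_ker_dim lf (vimage h V)) addnC; congr (_ + _)%N.
  congr (\dim _); apply/vspaceP => x; apply/idP/idP.
    case/memv_imgP => y /(vimageP Vs)[u Vu <-] ->.
    by rewrite lfunE /= hE row_mxKl mem_vimage.
  case/(vimageP Vs) => u Vu <-; apply/memv_imgP; exists (h u); first exact: mem_vimage.
  by rewrite lfunE /= hE row_mxKl.
rewrite -(@limg_dim_eq _ _ _ rf).
  congr (\dim _); apply/vspaceP => x; apply/idP/idP.
    case/memv_imgP => y; rewrite memv_cap => /andP[/(vimageP Vs)[u Vu <-] _ ->].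
    by rewrite lfunE /= hE row_mxKr mem_vimage.
  case/(vimageP Vs) => u Vu <-; have [v Vv [fv gv]] := Vg u Vu.
  apply/memv_imgP; exists (h v); last by rewrite lfunE /= hE row_mxKr.
  by rewrite memv_cap mem_vimage //= memv_ker lfunE /= hE row_mxKl fv.
apply/vspaceP => x; rewrite memv0; apply/idP/eqP => [|->]; last exact: mem0v.
rewrite !memv_cap !memv_ker !lfunE /= => /andP[/andP[_ /eqP xl] /eqP xr].
by rewrite -[x]hsubmxK xl xr row_mx0.
Qed.

End ImageDimension.

(** * Coefficients up to a given degree *)

Section Truncation.
Variables (p d : nat) (A : word_algebra p d).
Implicit Types (u v : A) (S V : set A) (n : nat).

Definition hcoef n u : 'rV['F_p]_#|{: n.-tuple 'I_d}%type| :=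
  \row_j wcoef (tval (enum_val j)) u.

Fact hcoef_is_linear n : linear (hcoef n).
Proof. by move=> a u v; apply/rowP => j; rewrite !mxE linearP. Qed.

HB.instance Definition _ n :=
  GRing.isLinear.Build 'F_p A _ *:%R (hcoef n) (hcoef_is_linear n).

Lemma hcoef0P n u : hcoef n u = 0 <-> forall w, size w = n -> wcoef w u = 0.
Proof.
split=> [/rowP u0 w /eqP wn|u0].
  by have := u0 (enum_rank (Tuple wn)); rewrite !mxE enum_rankK.
by apply/rowP => j; rewrite !mxE u0 // size_tuple.
Qed.

Fixpoint tsize n : nat :=
  if n is m.+1 then (tsize m + #|{: n.-tuple 'I_d}%type|)%N
  else #|{: 0.-tuple 'I_d}%type|.

(** The recursion appends one block per degree, so that [fdim_row_mx] computes dimensions degree by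
    degree. *)
Fixpoint tcoef n u : 'rV['F_p]_(tsize n) :=
  match n return 'rV['F_p]_(tsize n) with
  | 0 => hcoef 0 u
  | m.+1 => row_mx (tcoef m u) (hcoef m.+1 u)
  end.

Fact tcoef_is_linear n : linear (tcoef n).
Proof.
elim: n => [|n IHn] a u v; first exact: linearP.
by rewrite /= IHn linearP scale_row_mx add_row_mx.
Qed.

HB.instance Definition _ n :=
  GRing.isLinear.Build 'F_p A _ *:%R (tcoef n) (tcoef_is_linear n).

Lemma tcoef0P n u : tcoef n u = 0 <-> ord_ge n.+1 u.
Proof.
elim: n => [|n IHn].
  rewrite hcoef0P; split=> u0 w w0; apply: u0; first by case: (w) w0.
  by rewrite w0.
have -> : tcoef n.+1 u = 0 <-> tcoef n u = 0 /\ hcoef n.+1 u = 0.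
  rewrite /=; split=> [|[-> ->]]; last by rewrite row_mx0.
  by rewrite -row_mx0 => /eq_row_mx.
rewrite IHn hcoef0P; split=> [[un un1] w|u0].
  by rewrite ltnS leq_eqVlt => /orP[/eqP /un1|/un].
by split=> w; [move=> wn; apply: u0; rewrite ltnW|move=> wn; apply: u0; rewrite wn].
Qed.

Definition hdim n V := fdim (hcoef n) V.
Definition tdim n V := fdim (tcoef n) V.

Lemma hdim_le n V : (hdim n V <= d ^ n)%N.
Proof. by apply: leq_trans (fdim_le _ _) _; rewrite card_tuple card_ord. Qed.

(** The component of degree n + 1 has the same last block as the element itself and zeros before
    it. *)
Lemma tdimS n V : submodule V -> comp_closed V ->
  tdim n.+1 V = (tdim n V + hdim n.+1 V)%N.
Proof.
move=> Vs Vc; apply: fdim_row_mx => // u Vu.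
exists (hcomp n.+1 u); first exact: Vc.
split; first by apply/tcoef0P => w wn; rewrite (homog_comp (n := n.+1)) // ltn_eqF.
apply/rowP => j; rewrite !mxE wcoef_comp size_tuple eqxx; exact: mulr1n.
Qed.

Lemma tdim0 V : V `<=` [set u | ord_ge 1 u] -> tdim 0 V = 0%N.
Proof.
move=> V1; apply/eqP; rewrite -leqn0.
have /dimvS : (vimage (tcoef 0) V <= 0)%VS.
  by apply: vimage_min => u /V1 /tcoef0P /= u0; rewrite u0 mem0v.
by rewrite dimv0.
Qed.

Lemma leq_tdim n V W : V `<=` W -> (tdim n V <= tdim n W)%N.
Proof. exact: fdimS. Qed.

Lemma leq_hdim n V W : V `<=` W -> (hdim n V <= hdim n W)%N.
Proof. exact: fdimS. Qed.

Lemma tdim_sub n V W :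
  (forall u, V u -> exists2 v, W v & ord_ge n.+1 (u - v)) ->
  (tdim n V <= tdim n W)%N.
Proof.
move=> VW; apply: fdim_sub => u /VW[v Wv uv]; exists v => //.
by apply/eqP; rewrite -subr_eq0 -linearB; apply/eqP/tcoef0P.
Qed.

End Truncation.

(** * The free Lie algebra inside the free restricted Lie algebra *)

Section LinearSpan.
Variables (F : fieldType) (M : lmodType F).
Implicit Types (G V : set M).

Definition lspan G : set M := smallest (@submodule F M) G.

Lemma lspan_submodule G : submodule (lspan G).
Proof.
split=> [V [Vs _]|a u v gu gv V VG]; first exact: submodule0.
by case: (VG) => Vs _; case: (Vs) => _; apply; [apply: gu|apply: gv].
Qed.

Lemma sub_lspan G : G `<=` lspan G.
Proof. exact: sub_gen_smallest. Qed.

Lemma lspan_min G V : submodule V -> G `<=` V -> lspan G `<=` V.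
Proof. exact: smallest_sub. Qed.

Lemma lspanS G G' : G `<=` G' -> lspan G `<=` lspan G'.
Proof.
move=> GG'; apply: lspan_min; first exact: lspan_submodule.
by move=> x /GG'; apply: sub_lspan.
Qed.

End LinearSpan.

Section FreeLie.
Variables (p d : nat) (p_prime : prime p) (A : word_algebra p d).
Implicit Types (u v w : A) (V S : set A) (t : bracket d).

Lemma submodule_liel V v : submodule V -> submodule [set u | V (lie u v)].
Proof.
move=> Vs; split=> [|a u u' Vu Vu'] /=; first by rewrite lie0l; exact: (submodule0 Vs).
rewrite lieDl; apply: (submoduleD Vs) => //.
by rewrite /lie -scalerAl scale_mulr -scalerBr; apply: (submoduleZ Vs).
Qed.

Lemma submodule_lier V u : submodule V -> submodule [set v | V (lie u v)].
Proof.
move=> Vs; have [V0 Vl] := submodule_liel u Vs.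
have VE v : V (lie u v) <-> V (lie v u).
  by split=> /(submoduleN Vs); rewrite -lieC.
split=> [|a v v' /= /VE Vv /VE Vv']; first exact/VE.
by apply/VE/Vl.
Qed.

Lemma submodule_forall (I : Type) (Q : I -> set A) :
  (forall i, submodule (Q i)) -> submodule [set u | forall i, Q i u].
Proof.
move=> Qs; split=> [i|a u v Qu Qv i] /=; first exact: submodule0.
by case: (Qs i) => _; apply.
Qed.

Lemma submodule_imply (P : Prop) V : submodule V -> submodule [set u | P -> V u].
Proof.
move=> Vs; split=> [_|a u v Qu Qv HP] /=; first exact: submodule0.
by case: (Vs) => _; apply; [apply: Qu|apply: Qv].
Qed.

Fixpoint bval t : A :=
  match t with
  | Gen i => letter A i
  | Bracket t1 t2 => lie (bval t1) (bval t2)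
  end.

Definition rfree : set A := restricted_gen p (range (letter A)).

Definition flie : set A := lspan (range bval).

Lemma weight_gt0 t : (0 < weight t)%N.
Proof. by elim: t => //= t1 IH1 t2 IH2; rewrite addn_gt0 IH1. Qed.

Lemma homog_bval t : homog (weight t) (bval t).
Proof. by elim: t => [i|t1 IH1 t2 IH2] /=; [exact: homog_letter|exact: homog_lie]. Qed.

Lemma rfree_lie : restricted_lie p rfree.
Proof. exact: restricted_gen_lie. Qed.

Lemma submodule_rfree : submodule rfree.
Proof. exact/restricted_lie_submodule/rfree_lie. Qed.

Lemma submodule_flie : submodule flie.
Proof. exact: lspan_submodule. Qed.

Lemma rfree_bval t : rfree (bval t).
Proof.
elim: t => [i|t1 IH1 t2 IH2] /=; first by apply: sub_restricted_gen; exists i.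
by case: rfree_lie => _ _ _ RL _; apply: RL.
Qed.

Lemma flie_rfree : flie `<=` rfree.
Proof.
by apply: lspan_min; [exact: submodule_rfree|move=> _ [t _ <-]; exact: rfree_bval].
Qed.

Lemma rfree_comp : comp_closed rfree.
Proof.
move=> u n; apply: (restricted_gen_comp p_prime) => _ [i _ <-].
by exists 1%N; exact: homog_letter.
Qed.

Lemma lspan_comp (G : set A) :
  (forall u, G u -> exists n, homog n u) -> comp_closed (lspan G).
Proof.
move=> Gh u n; move: u n; suff : lspan G `<=` [set u | forall n, lspan G (hcomp n u)].
  by move=> GG u n /GG.
have Gs := lspan_submodule G.
apply: lspan_min.
  apply: (@submodule_forall _ (fun n u => lspan G (hcomp n u))) => n.
  split=> [|a u v Gu Gv]; first by rewrite raddf0; exact: (submodule0 Gs).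
  by rewrite linearP; case: (Gs) => _; apply.
move=> u Gu n /=; have [m hm] := Gh u Gu; rewrite (comp_homog_eq _ hm).
by case: (n == m); [exact: sub_lspan|exact: (submodule0 Gs)].
Qed.

Lemma flie_comp : comp_closed flie.
Proof.
by apply: lspan_comp => _ [t _ <-]; exists (weight t); exact: homog_bval.
Qed.

Lemma flie_lie u v : flie u -> flie v -> flie (lie u v).
Proof.
move=> fu; move: v; suff : flie `<=` [set v | flie (lie u v)] by [].
apply: lspan_min => [|_ [t _ <-]]; first exact: (submodule_lier _ submodule_flie).
move: u fu; suff : flie `<=` [set u | flie (lie u (bval t))] by [].
apply: lspan_min => [|_ [t' _ <-]]; first exact: (submodule_liel _ submodule_flie).
by apply: sub_lspan; exists (Bracket t' t).
Qed.

(** The elements that normalise L form a restricted Lie algebra, by the Jacobi identity and ad(u^p)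
    = ad(u)^p, and the generators are among them. *)
Lemma flie_ideal u v : rfree u -> flie v -> flie (lie u v).
Proof.
move=> Ru; move: u Ru v; suff : rfree `<=` [set u | forall v, flie v -> flie (lie u v)] by [].
apply: restricted_gen_min => [|_ [i _ <-] v fv /=]; last first.
  by apply: flie_lie => //; apply: sub_lspan; exists (Gen i).
have Ns : submodule [set u | forall v, flie v -> flie (lie u v)].
  apply: (@submodule_forall _ (fun v u => flie v -> flie (lie u v))) => v.
  by apply: submodule_imply; exact: (submodule_liel _ submodule_flie).
split=> /=.
- exact: (submodule0 Ns).
- exact: (submoduleD Ns).
- by move=> a u; apply: (submoduleZ Ns).
- move=> u v Nu Nv w fw; rewrite jacobi.
  by apply: (submoduleB submodule_flie); [apply: Nu; apply: Nv|apply: Nv; apply: Nu].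
- move=> u Nu v fv; rewrite (lie_pX p_prime).
  suff iterL k : flie (iter k (lie u) v) by exact: iterL.
  elim: k => [|k IHk]; [by []|rewrite iterS; exact: Nu].
Qed.

(** The elements of R whose brackets with R fall into L form a restricted Lie algebra; it contains
    the generators because these lie in the ideal L. *)
Lemma rfree_commutator u v : rfree u -> rfree v -> flie (lie u v).
Proof.
have RL : restricted_lie p rfree := rfree_lie.
suff : rfree `<=` [set u | rfree u /\ forall v, rfree v -> flie (lie u v)].
  by move=> RR /RR[_ Ru] /Ru.
have Ns v' : submodule [set u | flie (lie u v')] by exact: (submodule_liel _ submodule_flie).
apply: restricted_gen_min; last first.
  move=> _ [i _ <-]; split; first by apply: sub_restricted_gen; exists i.
  move=> w Rw; rewrite lieC; apply: (submoduleN submodule_flie).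
  by apply: flie_ideal => //; apply: sub_lspan; exists (Gen i).
case: (RL) => R0 RD RZ RB RX.
split=> /=.
- by split=> // w Rw; exact: (submodule0 (Ns w)).
- move=> x y [Rx Nx] [Ry Ny]; split=> [|w Rw]; first exact: RD.
  by apply: (submoduleD (Ns w)); [exact: Nx|exact: Ny].
- move=> a x [Rx Nx]; split=> [|w Rw]; first exact: RZ.
  by apply: (submoduleZ (Ns w)); exact: Nx.
- move=> x y [Rx Nx] [Ry Ny]; split=> [|w Rw]; first exact: RB.
  rewrite jacobi; apply: (submoduleB submodule_flie).
    by apply: Nx; apply: RB.
  by apply: Ny; apply: RB.
- move=> x [Rx Nx]; split=> [|w Rw]; first exact: RX.
  have pE := prednK (prime_gt0 p_prime).
  have -> : lie (x ^+ p) w = iter p.-1.+1 (lie x) w by rewrite pE -lie_pX.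
  (* The innermost commutator already lies in L, and the ideal L absorbs the others. *)
  rewrite iterSr.
  suff iterL k : flie (iter k (lie x) (lie x w)) by exact: iterL.
  elim: k => [|k IHk]; [exact: Nx|rewrite iterS; exact: flie_ideal].
Qed.

Lemma rfree_ord_ge : rfree `<=` [set u | ord_ge 1 u].
Proof.
apply: restricted_gen_min; first exact: restricted_lie_ord_ge.
by move=> _ [i _ <-]; apply/homog_ord_ge/homog_letter.
Qed.

Lemma flie_powD u v : rfree u -> rfree v -> flie ((u + v) ^+ p - u ^+ p - v ^+ p).
Proof.
move=> Ru Rv; apply: (jacobson_lie p_prime submodule_flie).
- exact: rfree_commutator.
- by move=> x; exact: flie_ideal.
- by move=> x; exact: flie_ideal.
Qed.

Lemma flie_pow_sum (I : Type) (r : seq I) (f : I -> A) :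
  (forall i, rfree (f i)) ->
  flie ((\sum_(i <- r) f i) ^+ p - \sum_(i <- r) f i ^+ p).
Proof.
move=> Rf; elim: r => [|i r IHr].
  by rewrite !big_nil expr0n gtn_eqF ?prime_gt0 // subrr; exact: (submodule0 submodule_flie).
rewrite !big_cons; set s := \sum_(_ <- _) f _ in IHr *; set t := \sum_(_ <- _) _ in IHr *.
have Rs : rfree s by apply: (submodule_sum submodule_rfree).
have := submoduleD submodule_flie (flie_powD (Rf i) Rs) IHr.
by rewrite addrA subrK opprD addrA.
Qed.

(** The elements v + w^p form a restricted Lie algebra: the p-map is additive modulo L and commutes
    with scalars, brackets lie in L, and p-th powers take v = 0. *)
Lemma rfreeE u : rfree u -> exists2 v, flie v & exists2 w, rfree w & u = v + w ^+ p.
Proof.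
have RL : restricted_lie p rfree := rfree_lie.
have Fs := submodule_flie.
(* Membership in R is carried along because the p-th power of x takes w = x. *)
suff : rfree `<=` [set u | rfree u /\
    exists2 v, flie v & exists2 w, rfree w & u = v + w ^+ p].
  by move=> RR /RR[].
case: (RL) => R0 RD RZ RB RX.
have p0 : 0 = 0 ^+ p :> A by rewrite expr0n gtn_eqF // prime_gt0.
apply: restricted_gen_min; last first.
  move=> _ [i _ <-]; split; first by apply: sub_restricted_gen; exists i.
  exists (letter A i); first by apply: sub_lspan; exists (Gen i).
  by exists 0 => //; rewrite -p0 addr0.
split=> /=.
- split=> //; exists 0; first exact: (submodule0 Fs).
  by exists 0 => //; rewrite -p0 addr0.
- move=> x y [Rx [v fv [w Rw xE]]] [Ry [v' fv' [w' Rw' yE]]].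
  split; first exact: RD.
  exists (v + v' - ((w + w') ^+ p - w ^+ p - w' ^+ p)).
    apply: (submoduleB Fs); first exact: (submoduleD Fs).
    exact: flie_powD.
  exists (w + w'); first exact: RD.
  rewrite xE yE !opprB !addrA subrK.
  by rewrite [LHS](ACl (1*3*4*2)).
- move=> a x [Rx [v fv [w Rw xE]]]; split; first exact: RZ.
  exists (a *: v); first exact: (submoduleZ Fs).
  exists (a *: w); first exact: RZ.
  by rewrite xE (FermatZ p_prime) scalerDr.
- move=> x y [Rx _] [Ry _]; split; first exact: RB.
  exists (lie x y); first exact: rfree_commutator.
  by exists 0 => //; rewrite -p0 addr0.
- move=> x [Rx _]; split; first exact: RX.
  exists 0; first exact: (submodule0 Fs).
  by exists x => //; rewrite add0r.
Qed.

(** Modulo L, w^p is the sum of the p-th powers of the components of w; in degree n only the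
    component of degree n / p can contribute. *)
Lemma rfree_homogE n u : rfree u -> homog n u ->
  exists2 v, flie v & exists2 w, rfree w /\ homog (n %/ p)%N w &
    u = v + (w ^+ p) *+ (p %| n)%N.
Proof.
move=> Ru hu; have [v fv [w Rw uE]] := rfreeE Ru.
(* The bound is raised above n / p so that this component occurs in the sum. *)
have [N wN] := sum_comp w; have {wN} := wN (maxn N (n %/ p).+1) (leq_maxl _ _).
have : (n %/ p < maxn N (n %/ p).+1)%N by rewrite leq_max leqnn orbT.
set K := maxn _ _ => nK wK.
have Fs := submodule_flie.
pose s := \sum_(0 <= m < K) hcomp m w ^+ p.
have fs : flie (w ^+ p - s).
  by rewrite {1}wK; apply: flie_pow_sum => m; exact: rfree_comp.
exists (hcomp n v + hcomp n (w ^+ p - s)).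
  by apply: (submoduleD Fs); exact: flie_comp.
exists (hcomp (n %/ p)%N w); first by split; [exact: rfree_comp|exact: homog_comp].
have <- : hcomp n s = hcomp (n %/ p)%N w ^+ p *+ (p %| n)%N.
  have hp m : homog (m * p)%N (hcomp m w ^+ p) by apply/homogX/homog_comp.
  rewrite /s raddf_sum /=; under eq_bigr => m _ do rewrite (comp_homog_eq _ (hp m)).
  rewrite (bigD1_seq (n %/ p)%N) ?mem_index_iota ?iota_uniq //= dvdn_eq eq_sym.
  rewrite big1 ?addr0 // => m mn; case: eqP => // nE.
  by rewrite nE mulnK ?eqxx ?prime_gt0 in mn.
by rewrite -addrA -linearD subrK -linearD -uE /= comp_homog.
Qed.

(* A basis of the degree n / p part accounts, through its p-th powers, for all of
   the free restricted Lie algebra outside the free Lie algebra in degree n. *)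
Lemma hdim_rfree n : (hdim n rfree <= hdim n flie + d ^ (n %/ p))%N.
Proof.
have Rs := submodule_rfree; have Fs := submodule_flie.
pose m := (n %/ p)%N; pose U := vimage (@hcoef p d A m) rfree.
have /choice[b bP] : forall i : 'I_(\dim U), exists w,
    [/\ rfree w, homog m w & hcoef m w = (vbasis U)`_i].
  move=> i; have [|w Rw wi] := @vimageP _ _ _ (@hcoef p d A m) rfree (vbasis U)`_i Rs.
    by apply: (basis_mem (vbasisP U)); rewrite mem_nth // size_tuple.
  exists (hcomp m w); split; [exact: rfree_comp|exact: homog_comp|].
  rewrite -wi; apply/rowP => j; rewrite !mxE wcoef_comp size_tuple eqxx.
  exact: mulr1n.
apply: (@leq_trans (hdim n flie + size [seq b i ^+ p | i <- enum 'I_(\dim U)])); last first.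
  by rewrite leq_add2l size_map size_enum_ord; exact: hdim_le.
apply: fdim_le_span => u Ru.
have [|v fv [w [Rw hw] uE]] := @rfree_homogE n (hcomp n u) (rfree_comp n Ru).
  exact: homog_comp.
have hcu : hcoef n (hcomp n u) = hcoef n u.
  apply/rowP => j; rewrite !mxE wcoef_comp size_tuple eqxx; exact: mulr1n.
pose c i := coord (vbasis U) i (hcoef m w).
have wb : w = \sum_i c i *: b i.
  apply: wcoefP => x; have [xm|xm] := eqVneq (size x) m; last first.
    rewrite (hw x xm) raddf_sum big1 // => i _ /=; rewrite wcoefZ.
    by case: (bP i) => _ ->; rewrite ?mulr0.
  apply/eqP; rewrite -subr_eq0 -raddfB; apply/eqP; move: x xm; apply/hcoef0P.
  rewrite linearB linear_sum {1}(coord_vbasis (mem_vimage (@hcoef p d A m) Rw)).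
  apply/eqP; rewrite subr_eq0; apply/eqP; apply: eq_bigr => i _.
  by rewrite linearZ /=; case: (bP i) => _ _ ->.
have Rb i : rfree (c i *: b i) by apply: (submoduleZ Rs); case: (bP i).
(* The defect of additivity of the p-map on the expansion of w, which lies in L. *)
pose l : A := (w ^+ p - \sum_i (c i *: b i) ^+ p) *+ (p %| n)%N.
have fl : flie l.
  rewrite /l {1}wb; case: (p %| n)%N; last exact: (submodule0 Fs).
  exact: flie_pow_sum.
exists (v + l); first exact: (submoduleD Fs).
rewrite /= -hcu -linearB uE /l; case: (p %| n)%N; last first.
  by rewrite !mulr0n subrr linear0 mem0v.
rewrite !mulr1n opprD opprB addrACA subrr add0r addrC subrK linear_sum.
apply: memv_suml => i _; rewrite (FermatZ p_prime) linearZ memvZ //.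
by apply/memv_span/map_f/map_f; rewrite mem_enum.
Qed.

End FreeLie.

Arguments bval {p d} A t.
Arguments rfree {p d} A _.
Arguments flie {p d} A _.

(** * The quotients that occur in the density *)

Section Filtration.
Variables (p d : nat) (p_prime : prime p) (A : word_algebra p d).
Implicit Types (u v : A) (V S : set A) (n : nat).

Lemma sum_gt_homog V n : submodule V -> comp_closed V ->
  sum_gt (fun m => V `&` [set u | homog m u]) n = V `&` [set u | ord_ge n.+1 u].
Proof.
move=> Vs Vc; apply/seteqP; split=> [_ [N [v vP ->]]|u [Vu un]].
  have vnP m : (n < m)%N -> V (v m) /\ ord_ge n.+1 (v m).
    move=> nm; have [Vm hm] := vP m nm; split=> //.
    exact/(ord_geW nm)/homog_ord_ge.
  rewrite big_nat_cond; split.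
    by apply: (submodule_sum Vs) => m; rewrite andbT => /andP[nm _]; case: (vnP m nm).
  apply: (submodule_sum (submodule_ord_ge A n.+1)) => m.
  by rewrite andbT => /andP[nm _]; case: (vnP m nm).
have [N uN] := sum_comp u; exists (maxn N n.+1); exists (fun m => hcomp m u).
  by move=> m nm; split; [exact: Vc|exact: homog_comp].
rewrite {1}(uN (maxn N n.+1)) ?leq_maxl // (big_cat_nat (n := n.+1)) ?leq_maxr //=.
rewrite big_nat_cond big1 ?add0r // => m; rewrite andbT => mn.
apply: wcoefP => w; rewrite wcoef_comp raddf0.
by case: eqP => // wm; rewrite un // wm.
Qed.

(** Truncation has kernel R_(>n) on S + R_(>n) and the same image there as on S. *)
Lemma quot_dim_tdim S n : submodule S -> S `<=` rfree A ->
  quot_dim (sum_set S (rfree A `&` [set u | ord_ge n.+1 u]))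
           (rfree A `&` [set u | ord_ge n.+1 u]) = tdim n S.
Proof.
move=> Ss SR; set W := rfree A `&` _.
have Ws : submodule W.
  split=> [|a u v [Ru un] [Rv vn]].
    split; first exact: (submodule0 (submodule_rfree A)).
    exact: (submodule0 (submodule_ord_ge A n.+1)).
  split; first by case: (submodule_rfree A) => _; apply.
  by case: (submodule_ord_ge A n.+1) => _; apply.
have Vs : submodule (sum_set S W).
  split=> [|a _ _ [u Su [w Ww <-]] [v Sv [w' Ww' <-]]].
    exists 0; first exact: (submodule0 Ss).
    by exists 0; [exact: (submodule0 Ws)|rewrite addr0].
  exists (a *: u + v); first by case: Ss => _; apply.
  exists (a *: w + w'); first by case: Ws => _; apply.
  by rewrite scalerDr addrACA.
have VR : sum_set S W `<=` rfree A.
  move=> _ [u /SR Ru [w [Rw _] <-]]; exact: (submoduleD (submodule_rfree A)).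
rewrite (quot_dimE (f := @tcoef p d A n)) //.
  apply/eqP; rewrite eqn_leq; apply/andP; split.
    apply: fdim_sub => _ [u Su [w [_ /tcoef0P wn] <-]]; exists u => //.
    by rewrite linearD /= wn addr0.
  apply: fdimS => u Su; exists u => //; exists 0; last by rewrite addr0.
  exact: (submodule0 Ws).
move=> v /VR Rv; split=> [[_ /tcoef0P]//|/tcoef0P vn]; by split.
Qed.

Lemma quot_dim_rfree n :
  quot_dim (rfree A) (rfree A `&` [set u | ord_ge n.+1 u]) = tdim n (rfree A).
Proof.
apply: quot_dimE; first exact: submodule_rfree.
by move=> v Rv; split=> [[_ /tcoef0P]//|/tcoef0P vn]; split.
Qed.

End Filtration.

(** * Basic commutators *)

Section BracketCode.
Variable d : nat.

(** Generic trees make brackets a countable type; the numbering [pickle] later breaks ties between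
    brackets of equal weight. *)
Fixpoint bracket_code (t : bracket d) : GenTree.tree 'I_d :=
  match t with
  | Gen i => GenTree.Leaf i
  | Bracket u v => GenTree.Node 0 [:: bracket_code u; bracket_code v]
  end.

Fixpoint bracket_decode (c : GenTree.tree 'I_d) : option (bracket d) :=
  match c with
  | GenTree.Leaf i => Some (Gen i)
  | GenTree.Node _ [:: a; b] =>
      if (bracket_decode a, bracket_decode b) is (Some u, Some v)
      then Some (Bracket u v) else None
  | _ => None
  end.

Lemma bracket_codeK : pcancel bracket_code bracket_decode.
Proof. by elim=> //= u -> v ->. Qed.

End BracketCode.

HB.instance Definition _ (d : nat) :=
  Countable.copy (bracket d) (pcan_type (@bracket_codeK d)).

Section Brackets.
Variable d : nat.
Implicit Types t u v : bracket d.

(** The recursion is on depth, which is at most the weight. The list serves as a finite superset of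
    the brackets of weight at most n. *)
Fixpoint brackets n : seq (bracket d) :=
  if n is m.+1 then
    map (@Gen d) (enum 'I_d) ++
    [seq Bracket u v | u <- brackets m, v <- brackets m]
  else [::].

Lemma mem_brackets t n : (weight t <= n)%N -> t \in brackets n.
Proof.
have := weight_gt0 t; case: n => [|n]; first by case: (weight t).
elim: t n => [i|u IHu v IHv] n _ /=; rewrite mem_cat.
  by move=> _; rewrite map_f // mem_enum.
move=> uvn; have u0 := weight_gt0 u; have v0 := weight_gt0 v.
apply/orP; right; apply/allpairsP; exists (u, v) => /=.
by case: n uvn => [|n] uvn; [lia|split=> //; [apply: IHu; lia|apply: IHv; lia]].
Qed.

(** Weight first, ties broken by [pickle]: a lexicographic order on pairs of natural numbers is a
    well-order. *)
Lemma basic_order_exists : exists le : rel (bracket d), basic_order le.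
Proof.
pose key t : nat * nat := (weight t, pickle t).
pose le t u := (weight t < weight u)%N || ((weight t == weight u) && (pickle t <= pickle u)%N).
exists le; split; last by move=> u v _ _ uv; rewrite /le; lia.
apply: antisymmetric_wo_chain.
  move=> u v _ _; rewrite /le => uv; apply: (pcan_inj pickleK) => //.
  have : pickle u = pickle v by lia.
  by [].
move=> X _ [t0 Xt0].
have exw : exists n, `[< exists2 t, t \in X & weight t = n >].
  by exists (weight t0); apply/asboolP; exists t0.
case: (ex_minnP exw) => n /asboolP[t1 Xt1 wt1] nmin.
have exk : exists k, `[< exists2 t, t \in X & weight t = n /\ pickle t = k >].
  by exists (pickle t1); apply/asboolP; exists t1.
case: (ex_minnP exk) => k /asboolP[t Xt [wt kt]] kmin.
exists t; split=> // u Xu; rewrite /le wt kt.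
have nu : (n <= weight u)%N by apply: nmin; apply/asboolP; exists u.
move: nu; rewrite leq_eqVlt => /orP[/eqP nu|->] //.
by rewrite nu ltnn eqxx /=; apply: kmin; apply/asboolP; exists u.
Qed.

End Brackets.

Section HallBasis.
Variables (p d : nat) (A : word_algebra p d) (le : rel (bracket d)).
Hypothesis le_order : basic_order le.
Implicit Types t u v x y z : bracket d.

Let le_wo : wo_chain le (basic le). Proof. by case: le_order. Qed.

Lemma basic_le_total x y : basic le x -> basic le y -> le x y || le y x.
Proof. exact: wo_chainW. Qed.

Lemma basic_le_refl x : basic le x -> le x x.
Proof. exact: wo_chain_reflexive. Qed.

Lemma basic_le_anti x y : basic le x -> basic le y -> le x y -> le y x -> x = y.
Proof.
by move=> bx By xy yx; apply: (wo_chain_antisymmetric le_wo) => //; rewrite xy.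
Qed.

(** Transitivity follows from well-ordering by looking at the least element of {x, y, z}. *)
Lemma basic_le_trans x y z : basic le x -> basic le y -> basic le z ->
  le x y -> le y z -> le x z.
Proof.
move=> bx By bz xy yz.
pose X : {pred bracket d} := [pred t | t \in [:: x; y; z]].
have XE t : (t \in X) = (t \in [:: x; y; z]) by [].
have sX : sub_mem (mem X) (mem (basic le)).
  by move=> t; rewrite [in_mem _ _]XE !inE => /or3P[] /eqP ->.
have nX : nonempty X by exists x; rewrite XE mem_head.
have [m [[mX mmin] _]] := le_wo sX nX.
have mx : le m x by apply: mmin; rewrite XE !inE eqxx.
have my : le m y by apply: mmin; rewrite XE !inE eqxx orbT.
have mz : le m z by apply: mmin; rewrite XE !inE eqxx !orbT.
move: mX; rewrite XE !inE => /or3P[] /eqP mE; move: mx my mz; rewrite mE //.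
- by move=> yx _ _; rewrite (basic_le_anti bx By xy yx).
- by move=> _ zy _; rewrite -(basic_le_anti By bz yz zy).
Qed.

Definition basic_span n : set A :=
  lspan [set bval A t | t in [set t | basic le t /\ weight t = n]].

(** The termination measure of the collection argument: it drops when v is replaced by a larger
    basic bracket of weight at most n. *)
Let cnt n v := count (fun t => basic le t && ~~ le t v) (brackets d n).

Lemma count_above n v m : basic le v -> basic le m -> (weight m <= n)%N ->
  ~~ le m v -> (cnt n m < cnt n v)%N.
Proof.
move=> bv bm mn mv.
have vm : le v m by have := basic_le_total bv bm; rewrite (negPf mv) orbF.
have sub : subpred (fun t => basic le t && ~~ le t m) (fun t => basic le t && ~~ le t v).
  move=> t /andP[bt tm]; rewrite bt /=; apply: contra tm => tv.
  exact: basic_le_trans tv vm.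
have := count_predUI (fun t => basic le t && ~~ le t m) (pred1 m) (brackets d n).
rewrite [X in (_ + X)%N](eq_count (a2 := pred0)) => [|t /=]; last first.
  by case: eqP => [->|]; rewrite ?andbF // basic_le_refl ?andbF.
rewrite count_pred0 addn0 => E.
have c0 : (0 < count (pred1 m) (brackets d n))%N.
  by rewrite -has_count has_pred1 mem_brackets.
apply: (@leq_trans (cnt n m + count (pred1 m) (brackets d n))).
  by rewrite -addn1 leq_add2l.
rewrite -E.
apply: sub_count => t /= /orP[/sub //|/eqP ->].
by rewrite bm.
Qed.

Lemma submodule_basic_span n : submodule (basic_span n).
Proof. exact: lspan_submodule. Qed.

(** Hall's collection: induction on the total weight, then on the number of basic brackets above the
    smaller factor v. If u = [y, z] with z > v, then [u, v] is not basic and the Jacobi identity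
    gives [y, [z, v]] - [z, [y, v]]. The inner brackets have smaller weight, hence expand into basic
    ones, which exceed v by their weight. *)
Lemma basic_span_lie n u v : basic le u -> basic le v ->
  (weight u + weight v = n)%N -> basic_span n (lie (bval A u) (bval A v)).
Proof.
elim/ltn_ind: n u v => n IHn.
have Bs := submodule_basic_span n.
suff main k u v : basic le u -> basic le v -> (weight u + weight v = n)%N ->
    ~~ le u v -> (cnt n v < k)%N -> basic_span n (lie (bval A u) (bval A v)).
  move=> u v bu bv uvn; have := basic_le_total bu bv.
  have [uv _|uv _] := boolP (le u v); last exact: (main (cnt n v).+1).
  have [vu|vu] := boolP (le v u).
    by rewrite (basic_le_anti bu bv uv vu) lie_self; exact: (submodule0 Bs).
  rewrite lieC; apply: (submoduleN Bs); apply: (main (cnt n u).+1) => //.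
  by rewrite addnC.
elim: k u v => // k IHk u v bu bv uvn uv cv.
(* Both factors of every resulting commutator exceed v. *)
have key y z : basic le y -> basic le z -> (weight y + (weight z + weight v) = n)%N ->
    ~~ le y v -> ~~ le z v ->
    basic_span n (lie (bval A y) (lie (bval A z) (bval A v))).
  move=> by_ bz yzn yv zv.
  have y0 := weight_gt0 y; have z0 := weight_gt0 z.
  have zvn : (weight z + weight v < n)%N by lia.
  suff : basic_span (weight z + weight v)%N `<=` [set x | basic_span n (lie (bval A y) x)].
    by apply; exact: IHn.
  apply: lspan_min => [|_ [b [bb wb] <-]]; first exact: submodule_lier.
  have bv' : ~~ le b v by case: le_order => _; apply=> //; rewrite wb; lia.
  rewrite /=; have ybn : (weight y + weight b = n)%N by rewrite wb.
  have [yb|yb] := boolP (le y b); last first.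
    by apply: IHk => //; apply: leq_trans (count_above bv _ _ bv') _ => //; lia.
  have [be|be] := boolP (le b y).
    by rewrite (basic_le_anti by_ bb yb be) lie_self; exact: (submodule0 Bs).
  rewrite lieC; apply: (submoduleN Bs); apply: IHk => //; first by rewrite addnC.
  by apply: leq_trans (count_above bv _ _ yv) _ => //; lia.
case: u bu uvn uv => [i|y z] bu uvn uv.
  apply: sub_lspan; exists (Bracket (Gen i) v) => //; split=> //=.
  by rewrite bv uv.
have [zv|zv] := boolP (le z v).
  apply: sub_lspan; exists (Bracket (Bracket y z) v) => //; split=> //.
  by rewrite /= in bu *; rewrite bu bv uv zv.
move: bu; rewrite /= => /and4P[by_ bz yz _]; rewrite /= in uvn.
(* Here y exceeds z because [y, z] is basic, and z exceeds v. *)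
have yv : ~~ le y v.
  apply: contra yz => yv; apply: (basic_le_trans by_ bv bz yv).
  by have := basic_le_total bv bz; rewrite (negPf zv) orbF.
rewrite jacobi; apply: (submoduleB Bs); apply: key => //; lia.
Qed.

Lemma basic_span_bval t : basic_span (weight t) (bval A t).
Proof.
elim: t => [i|u IHu v IHv]; first by apply: sub_lspan; exists (Gen i).
rewrite /=; set n := (weight u + weight v)%N.
have Bs := submodule_basic_span n.
suff : basic_span (weight u) `<=` [set x | basic_span n (lie x (bval A v))] by apply.
apply: lspan_min => [|_ [a [ba wa] <-]]; first exact: submodule_liel.
suff : basic_span (weight v) `<=` [set x | basic_span n (lie (bval A a) x)] by apply.
apply: lspan_min => [|_ [b [bb wb] <-]]; first exact: submodule_lier.
by apply: basic_span_lie => //; rewrite wa wb.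
Qed.

(** Consequently a subspace that contains all basic commutators of weight n contains the degree n
    part of L. *)
Lemma basic_span_flie n (u : A) : flie A u -> basic_span n (hcomp n u).
Proof.
have Bs := submodule_basic_span n.
move: u; suff : flie A `<=` [set u : A | basic_span n (hcomp n u)] by [].
apply: lspan_min => [|_ [t _ <-]].
  split=> [|a u v Gu Gv] /=; first by rewrite raddf0; exact: (submodule0 Bs).
  by rewrite linearP; case: Bs => _; apply.
rewrite /= (comp_homog_eq _ (@homog_bval _ _ A t)); case: eqP => [->|_].
  exact: basic_span_bval.
exact: (submodule0 Bs).
Qed.

End HallBasis.

(** * Words without long powers of a letter *)

Section AvoidingWords.
Local Open Scope nat_scope.
Variables (d : nat) (s : 'I_d).
Implicit Types (w : seq 'I_d) (K L j n i : nat).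

(* The word s^j w has no factor s^K. *)
Fixpoint avoid K j w : bool :=
  if w is x :: w' then (j < K) && avoid K (if x == s then j.+1 else 0) w'
  else j < K.

Fixpoint words n : seq (seq 'I_d) :=
  if n is m.+1 then [seq x :: w | x <- enum 'I_d, w <- words m] else [:: [::]].

Lemma mem_words n w : (w \in words n) = (size w == n).
Proof.
elim: n w => [|n IHn] w; first by rewrite inE size_eq0.
apply/allpairsP/eqP => [[[x v] [_ vn ->]]|].
  by rewrite /= in vn *; rewrite IHn in vn; rewrite (eqP vn).
case: w => // x w [wn]; exists (x, w); split=> //; first by rewrite mem_enum.
by rewrite IHn wn.
Qed.

Lemma uniq_words n : uniq (words n).
Proof.
elim: n => [|n IHn] //; apply: allpairs_uniq => //; first exact: enum_uniq.
by move=> [x w] [y v] _ _ [-> ->].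
Qed.

Definition navoid K j n := count (avoid K j) (words n).

Lemma navoid_geq K j n : K <= j -> navoid K j n = 0.
Proof.
move=> Kj; rewrite /navoid (@eq_count _ _ pred0) ?count_pred0 // => w.
by case: w => [|x w] /=; rewrite ltnNge Kj.
Qed.

(** The first letter is s, which prolongs the run, or one of d - 1 others, which reset it. *)
Lemma navoidS K j n : j < K ->
  navoid K j n.+1 = navoid K j.+1 n + d.-1 * navoid K 0 n.
Proof.
move=> jK; rewrite /navoid /= count_flatten sumnE big_map big_map.
under eq_bigr => x _ do rewrite count_map.
rewrite (bigD1_seq s) ?mem_enum ?enum_uniq //=; congr (_ + _).
  by apply: eq_count => w; rewrite /= jK eqxx.
under eq_bigr => x xs.
  rewrite (@eq_count _ _ (avoid K 0)); last first.
    by move=> w; rewrite /= jK (negPf xs).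
  over.
rewrite big_const_seq iter_addn_0 mulnC; congr (_ * _).
rewrite -size_filter -[d in RHS]card_ord.
have -> : [seq x <- enum 'I_d | x != s] = rem s (enum 'I_d).
  by rewrite rem_filter ?enum_uniq.
by rewrite size_rem ?mem_enum // -cardE.
Qed.

Lemma avoid_leq K j j' w : j' <= j -> avoid K j w -> avoid K j' w.
Proof.
elim: w j j' => [|x w IHw] j j' jj' /=; first exact: leq_ltn_trans.
move=> /andP[jK wK]; rewrite (leq_ltn_trans jj' jK) /=.
by apply: IHw wK; case: ifP.
Qed.

Lemma avoidW K K' j w : K <= K' -> avoid K j w -> avoid K' j w.
Proof.
move=> KK'; elim: w j => [|x w IHw] j /=; first by move=> /leq_trans; apply.
by move=> /andP[jK /IHw ->]; rewrite (leq_trans jK).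
Qed.

Lemma navoid_leq K j j' n : j' <= j -> navoid K j n <= navoid K j' n.
Proof. by move=> jj'; apply: sub_count => w; apply: avoid_leq. Qed.

Lemma navoid_le_pow K j n : navoid K j n <= d ^ n.
Proof.
apply: leq_trans (count_size _ _) _.
by elim: n => [|n IHn] //=; rewrite size_allpairs size_enum_ord expnS leq_mul2l IHn orbT.
Qed.

Hypothesis d_gt1 : 1 < d.

Lemma leq_navoidS K n : 0 < K -> navoid K 0 n <= navoid K 0 n.+1.
Proof.
move=> K0; rewrite navoidS // (leq_trans _ (leq_addl _ _)) // leq_pmull //.
by rewrite -ltnS prednK // ltnW.
Qed.

(** Take i arbitrary letters, then one letter other than s, then any avoiding word: the bound on i +
    j keeps the first run of s short, and the separating letter resets it. *)
Lemma navoid_ge L j n i : i.+1 + j <= L ->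
  d ^ i * d.-1 * navoid L 0 n <= navoid L j (n + i.+1).
Proof.
elim: i j n => [|i IHi] j n ijL.
  by rewrite mul1n addn1 navoidS ?leq_addl.
have jL : j < L by lia.
have ij1 : i.+1 + j.+1 <= L by lia.
have i0 : i.+1 + 0 <= L by lia.
rewrite addnS navoidS // expnS.
have h1 := IHi _ n ij1; have h2 := IHi _ n i0.
have -> : d * d ^ i * d.-1 * navoid L 0 n =
   d ^ i * d.-1 * navoid L 0 n + d.-1 * (d ^ i * d.-1 * navoid L 0 n).
  by rewrite -{1}(prednK (ltnW d_gt1)) mulSn !mulnDl -!mulnA.
by apply: leq_add => //; rewrite leq_mul2l h2 orbT.
Qed.

Lemma navoid_exp_ge L q : 0 < L -> (d ^ L.-1 * d.-1) ^ q <= navoid L 0 (q * L).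
Proof.
move=> L0; elim: q => [|q IHq]; first by rewrite mul0n /navoid /= L0.
have LL : L.-1.+1 + 0 <= L by rewrite prednK // addn0.
have := navoid_ge (q * L) LL; rewrite prednK // mulSn addnC => h.
by rewrite expnS; apply: leq_trans h; rewrite leq_mul2l IHq orbT.
Qed.

(** There are d^i prefixes, and the prefix s^i is lost as soon as it completes s^K together with the
    preceding s^j. *)
Lemma navoid_add_le K j n i :
  navoid K j (n + i) + (K <= i + j) * navoid K 0 n <= d ^ i * navoid K 0 n.
Proof.
elim: i j => [|i IHi] j.
  rewrite addn0 add0n mul1n; have [Kj|jK] := leqP K j.
    by rewrite navoid_geq // mul1n.
  by rewrite mul0n addn0 navoid_leq.
have [Kj|jK] := leqP K j.
  rewrite navoid_geq // add0n leq_mul2r (leq_trans (leq_b1 _)) ?orbT //.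
  by rewrite expn_gt0 (ltnW d_gt1).
rewrite addnS navoidS // addSnnS expnS -[X in X * _ ^ _](prednK (ltnW d_gt1)).
have h1 := IHi j.+1; have h2 := IHi 0.
have h3 : navoid K 0 (n + i) <= d ^ i * navoid K 0 n by apply: leq_trans h2; rewrite leq_addr.
rewrite mulSn mulnDl addnAC; apply: leq_add => //.
by rewrite -mulnA leq_mul2l h3 orbT.
Qed.

(** Each of the q blocks of K letters misses at least the choice s^K. *)
Lemma navoid_exp_le K q r : navoid K 0 (q * K + r) <= (d ^ K).-1 ^ q * d ^ r.
Proof.
elim: q => [|q IHq]; first by rewrite mul0n mul1n navoid_le_pow.
have -> : q.+1 * K + r = q * K + r + K by rewrite mulSn; lia.
have h : navoid K 0 (q * K + r + K) <= (d ^ K).-1 * navoid K 0 (q * K + r).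
  have := navoid_add_le K 0 (q * K + r) K; rewrite addn0 leqnn mul1n => h.
  rewrite -(leq_add2r (navoid K 0 (q * K + r))) (leq_trans h) //.
  by rewrite -mulSnr prednK // expn_gt0 (ltnW d_gt1).
apply: leq_trans h _.
by rewrite expnS -mulnA leq_mul2l IHq orbT.
Qed.

End AvoidingWords.

(** * Bernoulli's inequality *)

Section Bernoulli.
Local Open Scope nat_scope.

(** This is 1 + t/Y <= (1 + 1/Y)^t with denominators cleared. *)
Lemma bernoulli_expn Y t : (Y + t) * Y ^ t <= Y.+1 ^ t * Y.
Proof.
elim: t => [|t IHt]; first by rewrite addn0 muln1 mul1n.
rewrite !expnS -mulnA; apply: (@leq_trans (Y.+1 * ((Y + t) * Y ^ t))); last first.
  by rewrite leq_mul2l IHt orbT.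
by rewrite mulnCA !mulnA leq_mul2r; apply/orP; right; nia.
Qed.

Lemma four_expn Y : 0 < Y -> 4 * Y ^ (3 * Y) <= Y.+1 ^ (3 * Y).
Proof.
move=> Y0; rewrite -(leq_pmul2r Y0) (leq_trans _ (bernoulli_expn _ _)) //.
by rewrite -mulSn mulnAC.
Qed.

End Bernoulli.

(** * Lower bound by leading words *)

Section WordValue.
Variable d : nat.
Implicit Types w z : seq 'I_d.

(* Among words of the same length this is the lexicographic order. *)
Definition wval w : nat := foldl (fun n (x : 'I_d) => n * d + x)%N 0%N w.

Lemma wval_cat w z : wval (w ++ z) = (wval w * d ^ size z + wval z)%N.
Proof.
elim/last_ind: z => [|z x IHz]; first by rewrite cats0 muln1 addn0.
by rewrite -rcons_cat /wval !foldl_rcons -!/(wval _) IHz size_rcons expnSr; ring.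
Qed.

Lemma wval_cons (x : 'I_d) w : wval (x :: w) = (x * d ^ size w + wval w)%N.
Proof. by rewrite -cat1s wval_cat /wval /= mul0n add0n. Qed.

Lemma wval_lt w : (wval w < d ^ size w)%N.
Proof.
elim: w => [|x w IHw] //; rewrite wval_cons /= expnS.
have := ltn_ord x; nia.
Qed.

Lemma wval_lt_cons (x y : 'I_d) w z : size w = size z -> (x < y)%N ->
  (wval (x :: w) < wval (y :: z))%N.
Proof. by move=> wz xy; rewrite !wval_cons wz; have := wval_lt w; rewrite wz; nia. Qed.

Lemma wval_lt_catl u w z : size w = size z -> (wval w < wval z)%N ->
  (wval (u ++ w) < wval (u ++ z))%N.
Proof. by move=> wz; rewrite !wval_cat wz ltn_add2l. Qed.

Lemma wval_lt_catP w w' z z' : size w = size w' -> size z = size z' ->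
  (wval (w ++ z) < wval (w' ++ z'))%N ->
  (wval w < wval w')%N \/ wval w = wval w' /\ (wval z < wval z')%N.
Proof.
move=> ww zz; rewrite !wval_cat zz.
have := wval_lt z; have := wval_lt z'; rewrite zz.
set X := (d ^ _)%N; case: (ltngtP (wval w) (wval w')) => [|wlt|->]; first by left.
  by nia.
by rewrite ltn_add2l; right.
Qed.

Lemma wval_inj w z : size w = size z -> wval w = wval z -> w = z.
Proof.
elim: w z => [|x w IHw] [|y z] //= [wz] E.
have [xy|yx|/val_inj xy] := ltngtP x y.
- by have := wval_lt_cons wz xy; rewrite E ltnn.
- by have := wval_lt_cons (esym wz) yx; rewrite E ltnn.
- move: E; rewrite !wval_cons xy wz => /addnI E.
  by rewrite (IHw z wz E).
Qed.

End WordValue.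

Section LeadingWords.
Variables (p d : nat) (A : word_algebra p d).
Implicit Types (u v : A) (w z : seq 'I_d).

Definition lead u w : Prop :=
  [/\ homog (size w) u, wcoef w u = 1 &
    forall z, size z = size w -> (wval w < wval z)%N -> wcoef z u = 0].

Lemma leadM u v w z : lead u w -> lead v z -> lead (u * v) (w ++ z).
Proof.
move=> [hu uw uhi] [hv vz vhi]; split.
- by rewrite size_cat; exact: homogM.
- by rewrite (wcoefM_homog _ _ hu) // uw vz mulr1.
move=> x; rewrite size_cat => xs.
have tx : size (take (size w) x) = size w by rewrite size_takel // xs leq_addr.
have dx : size (drop (size w) x) = size z by rewrite size_drop xs addKn.
rewrite -(cat_take_drop (size w) x) => /(wval_lt_catP (esym tx) (esym dx)).
rewrite (wcoefM_homog _ _ hu) // => -[lt|[_ lt]].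
  by rewrite uhi // mul0r.
by rewrite vhi // mulr0.
Qed.

(** By the last hypothesis the product v u has a smaller leading word and cannot interfere. *)
Lemma lead_lie u v w z : lead u w -> lead v z ->
  (wval (z ++ w) < wval (w ++ z))%N -> lead (lie u v) (w ++ z).
Proof.
move=> lu lv lt; have [h1 c1 hi1] := leadM lu lv; have [h2 c2 hi2] := leadM lv lu.
have sz : size (w ++ z) = size (z ++ w) by rewrite !size_cat addnC.
split.
- by rewrite size_cat; apply: homog_lie; [case: lu|case: lv].
- by rewrite linearB /= c1 hi2 // subr0.
- move=> x xs xlt; rewrite linearB /= hi1 // hi2 ?subr0 // ?xs //.
  exact: ltn_trans lt xlt.
Qed.

Lemma lead_letter i : lead (letter A i) [:: i].
Proof.
split; first exact: homog_letter; first by rewrite wcoef_letter eqxx.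
by move=> z _ lt; rewrite wcoef_letter; case: eqP lt => // ->; rewrite ltnn.
Qed.

(** Elements with distinct leading words are independent: in a linear relation the largest leading
    word cannot cancel. *)
Lemma hdim_lead (V : set A) n (ws : seq (seq 'I_d)) : uniq ws ->
  (forall w, w \in ws -> size w = n /\ exists2 u, V u & lead u w) ->
  (size ws <= hdim n V)%N.
Proof.
move=> uws wsV; pose x (i : 'I_(size ws)) := nth [::] ws i.
have xws i : x i \in ws by exact: mem_nth.
have /choice[b bP] : forall i, exists u, V u /\ lead u (x i).
  by move=> i; have [_ [u Vu lu]] := wsV _ (xws i); exists u.
apply: (fdim_free (b := b)) => [i|c /hcoef0P c0 i]; first by case: (bP i).
apply/eqP; apply/negP => /negP ci.
case: (@arg_maxnP _ i (fun j => c j != 0) (fun j => wval (x j)) ci) => j cj jmax.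
have [jn _] := wsV _ (xws j).
have := c0 _ jn; rewrite raddf_sum (bigD1 j) //= wcoefZ.
have [_ [_ -> _]] := bP j; rewrite mulr1 big1 ?addr0 => [|k kj]; first by move/eqP: cj.
rewrite wcoefZ; have [->|ck] := eqVneq (c k) 0; first exact: mul0r.
have [kn _] := wsV _ (xws k); have [_ [_ _ khi]] := bP k.
rewrite khi ?mulr0 // ?jn ?kn //; have := jmax k ck; rewrite /= leq_eqVlt => /orP[|//].
move=> /eqP /(wval_inj (etrans kn (esym jn))) /eqP.
by rewrite nth_uniq // => /eqP/val_inj/eqP; rewrite (negPf kj).
Qed.

Variable s : 'I_d.

(** For i <> s these are the generators that appear in Lazard's elimination of the letter s. *)
Definition block i j : A := iter j (lie (letter A s)) (letter A i).

Lemma block_bval i j : exists2 t, bval A t = block i j & weight t = j.+1.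
Proof.
elim: j => [|j [t tE tw]]; first by exists (Gen i).
by exists (Bracket (Gen s) t); rewrite /= ?tE ?tw.
Qed.

Lemma flie_block i j : flie A (block i j).
Proof. by have [t <- _] := block_bval i j; apply: sub_lspan; exists t. Qed.

Hypothesis s_max : forall i : 'I_d, (i <= s)%N.

Lemma lead_block i j : i != s -> lead (block i j) (nseq j s ++ [:: i]).
Proof.
move=> nis; have is_ : (i < s)%N by rewrite ltn_neqAle s_max andbT.
elim: j => [|j IHj]; first exact: lead_letter.
apply: (lead_lie (lead_letter s) IHj).
have -> : [:: s] ++ nseq j s ++ [:: i] = nseq j s ++ [:: s; i].
  by rewrite catA -[[:: s]]/(nseq 1 s) -nseqD addnC nseqD -catA.
rewrite -catA.
by apply: wval_lt_catl => //; apply: wval_lt_cons.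
Qed.

(* A word avoiding s^K becomes, once framed by s^K a and a, the leading word of
   a Lie element: the bracket of its blocks s^j x (x <> s) with ad(s)^K a. *)
Lemma lead_flie (a : 'I_d) K w : a != s -> avoid s K 0 w ->
  exists2 u, flie A u & lead u (nseq K s ++ a :: w ++ [:: a]).
Proof.
(* The word v is the part already bracketed, and s^j is the pending run before the rest w. *)
move=> as_ wK; suff gen_lead j (v : seq 'I_d) u : lead u (nseq K s ++ a :: v) -> flie A u ->
    avoid s K j w ->
    exists2 u, flie A u & lead u (nseq K s ++ a :: v ++ nseq j s ++ w ++ [:: a]).
  apply: (gen_lead 0%N [::] (block a K)) => //; first exact: lead_block.
  exact: flie_block.
have step i (z : seq 'I_d) y x : x != s -> (i < K)%N -> lead y (nseq K s ++ a :: z) ->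
    flie A y -> flie A (lie y (block x i)) /\
    lead (lie y (block x i)) (nseq K s ++ a :: (z ++ nseq i s ++ [:: x])).
  move=> xs iK ly fy; split; first exact: flie_lie fy (flie_block x i).
  have := lead_lie ly (lead_block i xs); rewrite -!catA /=; apply.
  have xlt : (x < s)%N by rewrite ltn_neqAle s_max andbT.
  (* Since i < K, the two orders of concatenation share the prefix s^i; then the wanted word
     continues with s and the other with x < s. *)
  have [m KE] : exists m, K = (i + m.+1)%N by exists (K - i.+1)%N; lia.
  rewrite KE nseqD -!catA /=; apply: wval_lt_catl; last apply: wval_lt_cons => //.
    by rewrite /= !(size_cat, size_nseq) /= !(size_cat, size_nseq) /=; lia.
  by rewrite /= !(size_cat, size_nseq) /= !(size_cat, size_nseq) /=; lia.
elim: w j v u {wK} => [|x w IHw] j v u lu fu /=.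
  by move=> jK; exists (lie u (block a j)); case: (step j v u a as_ jK lu fu).
move=> /andP[jK]; case: eqP => [-> wK|/eqP xs wK].
  have := IHw j.+1 v u lu fu wK.
  by rewrite -[in nseq j.+1 s]addn1 nseqD -catA.
have [fu' lu'] := step j v u x xs jK lu fu.
by have := IHw 0%N _ _ lu' fu' wK; rewrite /= -!catA.
Qed.

(** Framing is injective and adds K + 2 letters, whence the shift of the degree. *)
Lemma navoid_hdim K n : (1 < d)%N -> (navoid s K 0 n <= hdim (n + K.+2)%N (flie A))%N.
Proof.
move=> d1; have [a as_] : exists a : 'I_d, a != s.
  have d0 : (0 < d)%N by exact: ltnW.
  have [s0|] := eqVneq (val s) 0%N; last by exists (Ordinal d0); rewrite -val_eqE eq_sym.
  by exists (Ordinal d1); rewrite -val_eqE s0.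
pose frame w := nseq K s ++ a :: w ++ [:: a].
have -> : navoid s K 0 n = size [seq frame w | w <- words d n & avoid s K 0 w].
  by rewrite size_map size_filter.
apply: hdim_lead => [|_ /mapP[w wP ->]]; last first.
  move: wP; rewrite mem_filter mem_words => /andP[wK /eqP wn].
  split; last exact: lead_flie.
  by rewrite size_cat size_nseq /= size_cat wn /= addn1; lia.
rewrite map_inj_uniq ?filter_uniq ?uniq_words // => w z /eqP.
by rewrite eqseq_cat // eqxx /= eqseq_cons eqxx /= !cats1 => /eqP /rcons_inj[].
Qed.

End LeadingWords.

(** * Negligible subalgebras *)

Section BlockAlgebra.
Variables (p d : nat) (p_prime : prime p) (A : word_algebra p d) (s : 'I_d).
Implicit Types (u v : A) (w z : seq 'I_d) (N n j : nat).

(* The product of the blocks s^j x (x <> s) of s^j w; it is 0 by convention if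
   this word ends in s. *)
Fixpoint blockprod j w : A :=
  match w with
  | [::] => (j == 0)%:R
  | x :: w' => if x == s then blockprod j.+1 w' else block A s x j * blockprod 0 w'
  end.

(** For N > 0, the unital associative algebra generated by the blocks s^j x with j < N. The spanning
    set by words bounds its dimension in each degree by a count. *)
Definition block_alg N : set A :=
  lspan [set blockprod 0 w | w in [set w | avoid s N 0 w]].

Lemma submodule_block_alg N : submodule (block_alg N).
Proof. exact: lspan_submodule. Qed.

Lemma homog_block i j : homog j.+1 (block A s i j).
Proof. by have [t <- <-] := block_bval A s i j; exact: homog_bval. Qed.

Lemma homog_blockprod j w : homog (j + size w)%N (blockprod j w).
Proof.
elim: w j => [|x w IHw] j /=.
  rewrite addn0; case: j => [|j]; first exact: homog1.
  by move=> z _; rewrite raddf0.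
case: eqP => _; first by rewrite addnS -addSn.
by rewrite addnS -addSn; apply: homogM; [exact: homog_block|exact: (IHw 0%N)].
Qed.

(** If w ends in a letter other than s, concatenation creates no longer run of s; if a run is
    pending at its end, the product is 0. *)
Lemma blockprodM N j w z : avoid s N j w -> avoid s N 0 z ->
  blockprod j w * blockprod 0 z = 0 \/
  (blockprod j w * blockprod 0 z = blockprod j (w ++ z) /\ avoid s N j (w ++ z)).
Proof.
elim: w j => [|x w IHw] j /=.
  by case: j => [|j] jN zN; [right; rewrite mul1r|left; rewrite mul0r].
move=> /andP[->]; case: eqP => _ /IHw IH zN; first exact: IH.
rewrite -mulrA; case: (IH zN) => [->|[-> ->]]; first by left; rewrite mulr0.
by right.
Qed.

Lemma block_algM N u v : block_alg N u -> block_alg N v -> block_alg N (u * v).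
Proof.
have Es := submodule_block_alg N.
have sub_l v' : submodule [set u | block_alg N (u * v')].
  split=> [|a x y /= Ex Ey]; first by rewrite /= mul0r; exact: (submodule0 Es).
  by rewrite mulrDl -scalerAl; case: Es => _; apply.
have sub_r u' : submodule [set v | block_alg N (u' * v)].
  split=> [|a x y /= Ex Ey]; first by rewrite /= mulr0; exact: (submodule0 Es).
  by rewrite mulrDr scale_mulr; case: Es => _; apply.
move=> Eu; move: v; suff : block_alg N `<=` [set v | block_alg N (u * v)] by [].
apply: lspan_min => // _ [z zN <-].
move: u Eu; suff : block_alg N `<=` [set u | block_alg N (u * blockprod 0 z)] by [].
apply: lspan_min => // _ [w wN <-] /=.
have [->|[-> wzN]] := blockprodM wN zN; first exact: (submodule0 Es).
by apply: sub_lspan; exists (w ++ z).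
Qed.

Lemma block_alg1 N : (0 < N)%N -> block_alg N 1.
Proof. by move=> N0; apply: sub_lspan; exists [::]. Qed.

Lemma block_alg_block N i j : i != s -> (j < N)%N -> block_alg N (block A s i j).
Proof.
move=> /negPf is_ jN; apply: sub_lspan; exists (nseq j s ++ [:: i]) => /=.
  have: (0 + j < N)%N by [].
  elim: j 0%N {jN} => [|j IHj] k /=; rewrite ?addn0.
    by move=> kN; rewrite kN is_ (leq_ltn_trans _ kN).
  by rewrite eqxx addnS => kN; rewrite IHj // andbT; lia.
suff E k : blockprod k (nseq j s ++ [:: i]) = block A s i (k + j) by rewrite E.
elim: j k {jN} => [|j IHj] k /=; first by rewrite is_ addn0 mulr1.
by rewrite eqxx IHj addSnnS.
Qed.

Lemma block_algS N N' : (N <= N')%N -> block_alg N `<=` block_alg N'.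
Proof. by move=> NN'; apply: lspanS => _ [w wN <-]; exists w => //; exact: avoidW wN. Qed.

Lemma restricted_lie_block_alg N : (0 < N)%N -> restricted_lie p (block_alg N).
Proof.
move=> N0; have Es := submodule_block_alg N; split.
- exact: (submodule0 Es).
- exact: (submoduleD Es).
- by move=> a u; apply: (submoduleZ Es).
- by move=> u v Eu Ev; apply: (submoduleB Es); exact: block_algM.
- move=> u Eu; suff EX k : block_alg N (u ^+ k) by exact: EX.
  elim: k => [|k IHk]; first exact: block_alg1.
  by rewrite exprS; exact: block_algM.
Qed.

(* ad(s) is a derivation that sends the block s^j x to s^(j+1) x. *)
Lemma block_alg_ad N u : block_alg N u -> block_alg N.+1 (lie (letter A s) u).
Proof.
have Es := submodule_block_alg N.+1.
move: u; suff : block_alg N `<=` [set u | block_alg N.+1 (lie (letter A s) u)] by [].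
apply: lspan_min => [|_ [w wN <-]] /=; first exact: (submodule_lier _ Es).
elim: w 0%N wN => [|x w IHw] j /=.
  by move=> _; rewrite /lie mulr_natr mulr_natl subrr; exact: (submodule0 Es).
move=> /andP[jN]; case: (boolP (x == s)) => [_|xs] wN; first exact: IHw.
have -> : lie (letter A s) (block A s x j * blockprod 0 w) =
    block A s x j.+1 * blockprod 0 w + block A s x j * lie (letter A s) (blockprod 0 w).
  by rewrite [block A s x j.+1]iterS /lie mulrBl mulrBr !mulrA addrA subrK.
apply: (submoduleD Es); apply: block_algM.
- by apply: block_alg_block.
- by apply: (block_algS (leqnSn N)); apply: sub_lspan; exists w.
- by apply: block_alg_block => //; exact: ltnW.
- exact: IHw.
Qed.

Lemma block_alg_bval t : t <> Gen s -> block_alg (weight t) (bval A t).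
Proof.
elim: t => [i|t1 IH1 t2 IH2] ts /=.
  by apply: (@block_alg_block 1 i 0) => //; apply/eqP => is_; rewrite is_ in ts.
have w1 := weight_gt0 t1; have w2 := weight_gt0 t2.
have Es n := submodule_block_alg n.
have [e1|/eqP n1] := eqVneq t1 (Gen s); have [e2|/eqP n2] := eqVneq t2 (Gen s).
- by rewrite e1 e2 lie_self; exact: (submodule0 (Es _)).
- by rewrite e1 /=; apply: block_alg_ad; exact: IH2.
- rewrite e2 /= lieC addn1; apply: (submoduleN (Es _)); apply: block_alg_ad; exact: IH1.
- have w0 : (0 < weight t1 + weight t2)%N by rewrite addn_gt0 w1.
  case: (restricted_lie_block_alg w0) => _ _ _ EL _; apply: EL.
    by apply: block_algS (IH1 n1); exact: leq_addr.
  by apply: block_algS (IH2 n2); exact: leq_addl.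
Qed.

Lemma hdim_block_alg N n : (hdim n (block_alg N) <= navoid s N 0 n)%N.
Proof.
pose l := [seq hcoef n (blockprod 0 w) | w <- words d n & avoid s N 0 w].
have -> : navoid s N 0 n = size l by rewrite size_map size_filter.
have sub : submodule [set u : A | hcoef n u \in span l].
  split=> [|a u v /= hu hv]; first by rewrite /= linear0 mem0v.
  by rewrite linearP memvD ?memvZ.
suff EN : block_alg N `<=` [set u : A | hcoef n u \in span l].
  by apply: leq_trans (dimvS (vimage_min EN)) (dim_span _).
apply: lspan_min => // _ [w wN <-] /=.
have [wn|wn] := eqVneq (size w) n.
  by apply: memv_span; apply: map_f; rewrite mem_filter mem_words wn eqxx andbT.
suff -> : hcoef n (blockprod 0 w) = 0 by exact: mem0v.
apply/hcoef0P => z zn; rewrite homog_blockprod // zn add0n.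
by rewrite eq_sym.
Qed.

End BlockAlgebra.
Arguments block_alg {p d} A s N _.

(** * Comparison of growth rates *)

Section Growth.
Local Open Scope nat_scope.
Variables (p d : nat) (p_prime : prime p) (A : word_algebra p d).
Hypothesis d_gt1 : 1 < d.

(** Up to constant factors, L grows at least like (2M)^(n/L) and f at most like M^(n/L); the
    quotient 2^(n/L) outgrows any constant. *)
Lemma growth_flie (s : 'I_d) (f : nat -> nat) L M C c :
  (forall i : 'I_d, i <= s) ->
  0 < L -> 0 < M -> 2 * M <= d ^ L.-1 * d.-1 -> (forall n, f n <= C * M ^ (n %/ L)) ->
  exists n0, forall n, n0 <= n -> c * f n <= hdim n (flie A).
Proof.
(* The L + 2 letters of the frame cost at most three blocks of length L, hence the factor M^3; the
   bound on n then makes q - 3 at least k, and k < 2^k. *)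
move=> s_max L0 M0 LM fC; pose k := c * C * M ^ 3.
exists ((k + 3) * L + L.+2) => n nn.
have [m nE] : exists m, n = m + L.+2 by exists (n - L.+2); lia.
rewrite nE; apply: leq_trans (navoid_hdim A s_max L m d_gt1).
set q := (m + L.+2) %/ L.
have q3 : k + 3 <= q by rewrite /q leq_divRL // -nE; lia.
have qm : (q - 3) * L <= m.
  have := leq_divM (m + L.+2) L; rewrite -/q mulnBl; lia.
have mono : navoid s L 0 ((q - 3) * L) <= navoid s L 0 m.
  rewrite -(subnK qm); elim: (m - _) => [|i IHi] //.
  by apply: leq_trans IHi _; rewrite addSn; exact: leq_navoidS.
apply: leq_trans mono; apply: leq_trans (navoid_exp_ge s d_gt1 _ L0).
apply: (@leq_trans ((2 * M) ^ (q - 3))); last by case: (q - 3) => [|e] //; rewrite leq_exp2r.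
apply: (@leq_trans (k * M ^ (q - 3))).
  rewrite /k -mulnA -expnD subnKC ?(leq_trans _ q3) ?leq_addl //.
  by rewrite -mulnA leq_mul2l fC orbT.
rewrite expnMn leq_mul2r; apply/orP; right; apply: ltnW.
apply: leq_trans (ltn_expl _ (ltnSn 1)) _; rewrite leq_exp2l //; lia.
Qed.

Lemma growth_block_alg (s : 'I_d) N c : (forall i : 'I_d, i <= s) -> 0 < N ->
  exists n0, forall n, n0 <= n -> c * hdim n (block_alg A s N) <= hdim n (flie A).
Proof.
move=> s_max N0; pose Y := (d ^ N).-1.
have dN : d < d ^ N.+1 by rewrite -[X in X < _]expn1 ltn_exp2l.
have d0 : 0 < d by exact: ltnW.
have YE : Y.+1 = d ^ N by rewrite /Y prednK // expn_gt0 d0.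
have Y0 : 0 < Y by have : 1 < d ^ N by [rewrite -[1](expn0 d) ltn_exp2l|]; rewrite -YE.
(* A word of length L consists of 3Y blocks of N letters, which leaves at most Y^(3Y) avoiding
   words, a quarter of d^L by [four_expn]. As d - 1 >= d / 2, a factor 2 remains. *)
pose L := 3 * Y * N; have L0 : 0 < L by rewrite !muln_gt0 Y0 N0.
have M0 : 0 < Y ^ (3 * Y) by rewrite expn_gt0 Y0.
have LM : 2 * Y ^ (3 * Y) <= d ^ L.-1 * d.-1.
  have : 4 * Y ^ (3 * Y) <= d * d ^ L.-1.
    by rewrite -expnS (prednK L0) [L]mulnC (expnM d) -YE four_expn.
  have : d * d ^ L.-1 <= 2 * d.-1 * d ^ L.-1 by rewrite leq_mul2r; apply/orP; right; lia.
  by move: (d ^ L.-1) (Y ^ _) => a b; nia.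
have fC n : navoid s N 0 n <= d ^ L * (Y ^ (3 * Y)) ^ (n %/ L).
  rewrite {1}(divn_eq n L) /L mulnA (leq_trans (navoid_exp_le _ d_gt1 _ _ _)) //.
  rewrite -/L -/Y mulnC -expnM [3 * Y * _]mulnC leq_mul2r leq_exp2l //.
  by rewrite (ltnW (ltn_pmod _ L0)) orbT.
have [n0 nP] := growth_flie c s_max L0 M0 LM fC.
exists n0 => n /nP; apply: leq_trans; rewrite leq_mul2l hdim_block_alg ?orbT //.
Qed.

Lemma growth_pow c : exists n0, forall n, n0 <= n ->
  c * d ^ (n %/ p) <= hdim n (flie A).
Proof.
have d0 : 0 < d by exact: ltnW.
have sP : d.-1 < d by rewrite prednK.
have s_max (i : 'I_d) : i <= Ordinal sP by rewrite /= -ltnS prednK.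
(* The constants fit because n / p <= n / 2 <= 2 (n / 4) + 1 and 2 d^2 <= d^3 (d - 1). *)
apply: (@growth_flie (Ordinal sP) (fun n => d ^ (n %/ p)) 4 (d ^ 2) d c) => //.
- by rewrite expn_gt0 d0.
- by rewrite /= [X in _ <= X]mulnC (expnS d 2) mulnA leq_mul2r; apply/orP; right; nia.
move=> n; rewrite -expnM -expnS leq_exp2l //.
apply: leq_trans (leq_div2l n (isT : 0 < 2) (prime_gt1 p_prime)) _; lia.
Qed.

End Growth.

(** * Adjoining generators of top degree *)

Section Adjunction.
Variables (p d : nat) (p_prime : prime p) (A : word_algebra p d).
Implicit Types (u v : A) (B S E : set A) (n : nat).

(** Modulo order n + 1, elements of order n are central in positive order and do not affect p-th
    powers. Changing the generators by elements of E therefore changes the generated algebra only by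
    elements of E. *)
Lemma restricted_gen_adjoin B B' E n : (0 < n)%N ->
  B `<=` [set u | ord_ge 1 u] ->
  submodule E -> E `<=` [set u | ord_ge n u] -> [set u | ord_ge n.+1 u] `<=` E ->
  (forall u, B' u -> exists2 v, restricted_gen p B v & E (u - v)) ->
  forall u, restricted_gen p B' u -> exists2 v, restricted_gen p B v & E (u - v).
Proof.
move=> n0 B1 Es En nE B'B; set S := restricted_gen p B.
have SL : restricted_lie p S := restricted_gen_lie p B.
have S1 : S `<=` [set u | ord_ge 1 u].
  by apply: restricted_gen_min => //; exact: restricted_lie_ord_ge.
have o1 := submodule_ord_ge A 1.
have T1 u v : S v -> E (u - v) -> ord_ge 1 u.
  move=> Sv Euv; rewrite -[u](subrK v); apply: (submoduleD o1); last exact: S1.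
  exact/(ord_geW n0)/En.
case: SL => S0 SD SZ SB SX.
pose T := [set u | exists2 v, S v & E (u - v)].
suff : restricted_gen p B' `<=` T by [].
apply: restricted_gen_min => //; split.
- by exists 0 => //; rewrite subrr; exact: (submodule0 Es).
- move=> x y [x' Sx Ex] [y' Sy Ey]; exists (x' + y'); first exact: SD.
  by rewrite opprD addrACA; exact: (submoduleD Es).
- move=> a x [x' Sx Ex]; exists (a *: x'); first exact: SZ.
  by rewrite -scalerBr; exact: (submoduleZ Es).
- move=> x y [x' Sx Ex] [y' Sy Ey]; exists (lie x' y'); first exact: SB.
  have -> : lie x y - lie x' y' = lie (x - x') y + lie x' (y - y').
    by rewrite lieBl lieBr addrA subrK.
  apply: nE; apply: (submoduleD (submodule_ord_ge A n.+1)).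
    by rewrite /= -addn1; apply: ord_ge_lie; [exact: En|exact: T1 Ey].
  by rewrite /= -add1n; apply: ord_ge_lie; [exact: S1|exact: En].
- move=> x [x' Sx Ex]; exists (x' ^+ p); first exact: SX.
  have x1 := T1 _ _ Sx Ex; have x'1 := S1 _ Sx; have on1 := submodule_ord_ge A n.+1.
  have powE k : x ^+ k.+1 - x' ^+ k.+1 = (x ^+ k - x' ^+ k) * x + x' ^+ k * (x - x').
    by rewrite mulrBl mulrBr addrA subrK !exprSr.
  (* From the second power on, every term of the telescoped difference has x - x' multiplied by a
     factor of positive order. *)
  have pow k : ord_ge n.+1 (x ^+ k.+2 - x' ^+ k.+2).
    elim: k => [|k IHk]; rewrite powE; apply: (submoduleD on1).
    + by rewrite /= -addn1; apply: ord_geM => //; rewrite !expr1; exact: En.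
    + by rewrite /= -add1n expr1; apply: ord_geM => //; exact: En.
    + by apply: (@ord_geW _ _ _ _ (n.+1 + 1)%N); [rewrite addn1|apply: ord_geM].
    + apply: (@ord_geW _ _ _ _ (k.+2 + n)%N); first by rewrite addSn ltnS leq_addl.
      apply: ord_geM; last exact: En.
      by rewrite -[X in ord_ge X]mul1n; apply: ord_ge_exp.
  have pE : p = p.-2.+2 by have := prime_gt1 p_prime; lia.
  by apply: nE; have := pow p.-2; rewrite -pE.
Qed.

End Adjunction.

(** * Greedy choice of generators *)

Section Greedy.
Variables (p d : nat) (p_prime : prime p) (A : word_algebra p d).
Implicit Types (X Y : set (bracket d)) (t : bracket d) (n : nat).

Definition bracket_gen X : set A := restricted_gen p (bval A @` X).

Lemma bracket_genS X Y : X `<=` Y -> bracket_gen X `<=` bracket_gen Y.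
Proof. by move=> XY; apply: restricted_genS; exact: image_subset. Qed.

Lemma bval_ord_ge1 X : bval A @` X `<=` [set u | ord_ge 1 u].
Proof.
by move=> _ [t _ <-]; apply/(ord_geW (weight_gt0 t))/homog_ord_ge/homog_bval.
Qed.

Lemma submodule_bracket_gen X : submodule (bracket_gen X).
Proof. exact: restricted_gen_submodule. Qed.

Lemma bracket_gen_comp X : comp_closed (bracket_gen X).
Proof.
move=> u n; apply: (restricted_gen_comp p_prime) => _ [t _ <-].
by exists (weight t); exact: homog_bval.
Qed.

Lemma bracket_gen_rfree X : bracket_gen X `<=` rfree A.
Proof.
apply: restricted_gen_min; first exact: rfree_lie.
by move=> _ [t _ <-]; exact: rfree_bval.
Qed.

Lemma bracket_gen_ord_ge X : bracket_gen X `<=` [set u | ord_ge 1 u].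
Proof. by move=> u /bracket_gen_rfree; exact: rfree_ord_ge. Qed.

(** Generators of weight above n are invisible after truncation in degree n. *)
Lemma tdim_high X Y n : (forall t, Y t -> X t \/ (n < weight t)%N) ->
  (tdim n (bracket_gen Y) <= tdim n (bracket_gen X))%N.
Proof.
case: n => [|n] YX; first by rewrite tdim0 //; exact: bracket_gen_ord_ge.
have o := submodule_ord_ge A n.+2.
apply: tdim_sub => u; apply: (restricted_gen_adjoin p_prime (n := n.+1)) => //.
- exact: bval_ord_ge1.
- by move=> v vn; apply: ord_geW vn.
- move=> _ [t Yt <-]; case: (YX t Yt) => [Xt|tn].
    exists (bval A t); first by apply: sub_restricted_gen; exists t.
    by rewrite subrr; exact: (submodule0 o).
  exists 0; first exact: (submodule0 (submodule_bracket_gen X)).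
  rewrite subr0; exact/(ord_geW tn)/homog_ord_ge/homog_bval.
Qed.

(** A generator of top degree n contributes only its own line, so E is that line modulo order n +
    1. *)
Lemma tdim_add1 X t n : weight t = n ->
  (tdim n (bracket_gen (X `|` [set t])) <= (tdim n (bracket_gen X)).+1)%N.
Proof.
move=> tn; have n0 : (0 < n)%N by rewrite -tn weight_gt0.
pose E := [set u : A | exists c, ord_ge n.+1 (u - c *: bval A t)].
have o := submodule_ord_ge A n.+1.
have Es : submodule E.
  split=> [|a u v [c uc] [c' vc']] /=.
    by exists 0; rewrite scale0r subr0; exact: (submodule0 o).
  exists (a * c + c'); rewrite scalerDl -scalerA opprD addrACA -scalerBr.
  by case: o => _; apply.
rewrite -addn1 -[1%N]/(size [:: bval A t]); apply: fdim_le_span => u Su.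
have [|||v Sv [c uvc]] := restricted_gen_adjoin p_prime n0 (@bval_ord_ge1 X) Es _ _ _ Su.
- move=> v [c vc]; rewrite -[v](subrK (c *: bval A t)).
  apply: (submoduleD (submodule_ord_ge A n)); first exact: ord_geW vc.
  apply: (submoduleZ (submodule_ord_ge A n)); rewrite /= -{1}tn.
  exact/homog_ord_ge/homog_bval.
- by move=> v vn; exists 0; rewrite scale0r subr0.
- move=> _ [t' [Xt'|->] <-].
    exists (bval A t'); first by apply: sub_restricted_gen; exists t'.
    by rewrite subrr; exact: (submodule0 Es).
  exists 0; first exact: (submodule0 (submodule_bracket_gen X)).
  by exists 1; rewrite scale1r subr0 subrr; exact: (submodule0 o).
exists v => //; have /tcoef0P : ord_ge n.+1 (u - v - c *: bval A t) by [].
move/eqP; rewrite !linearB linearZ /= subr_eq0 => /eqP ->.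
by apply: memvZ; apply: memv_span; rewrite mem_head.
Qed.

Variable K : realType.

(* Brackets are adjoined one at a time, as long as the dimension stays below the
   target x; each of them raises it by at most one. *)
Lemma greedy_step X n (x : K) (ts : seq (bracket d)) :
  (forall t, t \in ts -> weight t = n) ->
  exists X', [/\ X `<=` X', forall t, X' t -> X t \/ t \in ts,
    X' `<=` X \/ (tdim n (bracket_gen X'))%:R <= x + 1 &
    (forall t, t \in ts -> X' t) \/ x <= (tdim n (bracket_gen X'))%:R].
Proof.
elim: ts => [|t ts IH] tsn.
  by exists X; split=> //; [move=> t; left|left|left].
have [|X' [XX' X'X X'le X'ge]] := IH; first by move=> u uts; rewrite tsn // inE uts orbT.
have [le|gt] := lerP x (tdim n (bracket_gen X'))%:R.
  exists X'; split=> //; last by right.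
  by move=> u /X'X[|uts]; [left|right; rewrite inE uts orbT].
exists (X' `|` [set t]); split=> [u /XX'|u [/X'X[|uts]|->]||]; first by left.
- by left.
- by right; rewrite inE uts orbT.
- by right; exact: mem_head.
- right; apply: (@le_trans _ _ ((tdim n (bracket_gen X')).+1)%:R).
    by rewrite ler_nat tdim_add1 // tsn // mem_head.
  by rewrite -natr1 lerD2r ltW.
- case: X'ge => [all|]; last by rewrite leNgt gt.
  by left=> u; rewrite inE => /orP[/eqP ->|/all]; [right|left].
Qed.

Variables (le : rel (bracket d)) (s : 'I_d).

Definition new_brackets n :=
  [seq t <- brackets d n | [&& basic le t, t != Gen s & weight t == n]].

Lemma mem_new_brackets n t :
  t \in new_brackets n = [&& basic le t, t != Gen s & weight t == n].
Proof.
rewrite mem_filter andbC; have [<-|_] := eqVneq (weight t) n; last by rewrite !andbF.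
by rewrite mem_brackets.
Qed.

Lemma greedy_sequence (x : nat -> K) : exists X : nat -> set (bracket d),
  [/\ forall m n, (m <= n)%N -> X m `<=` X n,
    forall m n t, X n t -> X m t \/ (m < weight t)%N,
    forall n t, X n t -> [/\ basic le t, t <> Gen s & (weight t <= n)%N],
    forall n, X n.+1 `<=` X n \/ (tdim n.+1 (bracket_gen (X n.+1)))%:R <= x n.+1 + 1 &
    forall n, (forall t, basic le t -> t <> Gen s -> weight t = n.+1 -> X n.+1 t) \/
      x n.+1 <= (tdim n.+1 (bracket_gen (X n.+1)))%:R].
Proof.
have step (nX : nat * set (bracket d)) : exists X', [/\ nX.2 `<=` X',
    forall t, X' t -> nX.2 t \/ t \in new_brackets nX.1,
    X' `<=` nX.2 \/ (tdim nX.1 (bracket_gen X'))%:R <= x nX.1 + 1 &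
    (forall t, t \in new_brackets nX.1 -> X' t) \/
      x nX.1 <= (tdim nX.1 (bracket_gen X'))%:R].
  apply: greedy_step => t; rewrite mem_new_brackets => /and3P[_ _ /eqP ->//].
have [g gP] := choice step.
(* The sequence starts empty since no bracket has weight 0; stage n treats weight n only. *)
pose X := fix X n := if n is m.+1 then g (n, X m) else set0.
have XS n : X n `<=` X n.+1 by case: (gP (n.+1, X n)).
have Xnew n t : X n.+1 t -> X n t \/ t \in new_brackets n.+1.
  by case: (gP (n.+1, X n)) => _ + _ _; apply.
have Xmono m n : (m <= n)%N -> X m `<=` X n.
  move=> /subnK <-; elim: (n - m)%N => [|k IHk] //.
  by rewrite addSn => t /IHk; exact: XS.
have Xgood n t : X n t -> [/\ basic le t, t <> Gen s & (weight t <= n)%N].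
  elim: n => [//|n IHn] /Xnew[/IHn[? ? ?]|]; first by split=> //; exact: leqW.
  by rewrite mem_new_brackets => /and3P[? /eqP ? /eqP ->].
exists X; split=> //.
- move=> m n t; have [nm|mn] := leqP n m; first by move=> /(Xmono n m nm); left.
  rewrite -(subnK (ltnW mn)); elim: (n - m)%N => [|k IHk]; first by left.
  rewrite addSn => /Xnew[/IHk//|]; rewrite mem_new_brackets => /and3P[_ _ /eqP ->].
  by right; rewrite ltnS leq_addl.
- by move=> n; case: (gP (n.+1, X n)).
- move=> n; case: (gP (n.+1, X n)) => _ _ _ [all|]; last by right.
  left=> t bt ts tn; apply: all; rewrite mem_new_brackets bt tn eqxx andbT.
  exact/eqP.
Qed.

End Greedy.
Arguments bracket_gen {p d} A X _.

(** * Densities *)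

Section LowerLimit.
Variable R : realType.
Implicit Types (u : nat -> R) (a b e : R) (n : nat).

Let unit_seq u := forall n, 0 <= u n <= 1.

Lemma unit_seq_infs u n m : unit_seq u -> (n <= m)%N -> infs u n <= u m.
Proof.
move=> u01 nm; apply: ge_inf; last by exists m.
by exists 0 => _ [k _ <-]; case/andP: (u01 k).
Qed.

Lemma unit_seq_le_infs u n b : (forall m, (n <= m)%N -> b <= u m) -> b <= infs u n.
Proof.
move=> bu; apply: lb_le_inf; first by exists (u n); exists n => /=.
by move=> _ [m /= nm <-]; exact: bu.
Qed.

Lemma unit_seq_limn_infE u : unit_seq u -> limn_inf u = sup (range (infs u)).
Proof.
move=> u01; apply/cvg_lim => //; apply: cvg_infs_sup.
  by exists 1 => _ [k _ <-]; case/andP: (u01 k).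
by exists 0 => _ [k _ <-]; case/andP: (u01 k).
Qed.

Lemma unit_seq_infs_le1 u : unit_seq u -> ubound (range (infs u)) 1.
Proof.
move=> u01 _ [n _ <-]; apply: le_trans (unit_seq_infs u01 (leqnn n)) _.
by case/andP: (u01 n).
Qed.

Lemma unit_seq_limn_inf u : unit_seq u -> 0 <= limn_inf u <= 1.
Proof.
move=> u01; rewrite unit_seq_limn_infE //; apply/andP; split.
  apply: (@le_trans _ _ (infs u 0%N)).
    by apply: unit_seq_le_infs => m _; case/andP: (u01 m).
  apply: ub_le_sup; last by exists 0%N.
  by exists 1; exact: unit_seq_infs_le1.
apply: ge_sup; last exact: unit_seq_infs_le1.
by exists (infs u 0%N); exists 0%N.
Qed.

Lemma limn_inf_eq u a : unit_seq u ->
  (forall e, 0 < e -> exists N, forall n, (N <= n)%N -> a - e <= u n) ->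
  (forall e N, 0 < e -> exists2 n, (N <= n)%N & u n <= a + e) ->
  limn_inf u = a.
Proof.
move=> u01 lo hi; rewrite unit_seq_limn_infE //; apply/eqP; rewrite eq_le.
apply/andP; split.
  apply: ge_sup; first by exists (infs u 0%N); exists 0%N.
  move=> _ [n _ <-]; apply/ler_addgt0Pr => e e0.
  by have [m nm um] := hi e n e0; apply: le_trans (unit_seq_infs u01 nm) um.
apply/ler_addgt0Pr => e e0; rewrite -lerBlDr.
have [N uN] := lo e e0; apply: le_trans (unit_seq_le_infs uN) _.
apply: ub_le_sup; last by exists N.
by exists 1; exact: unit_seq_infs_le1.
Qed.

End LowerLimit.

Section Density.
Variables (p d : nat) (p_prime : prime p) (A : word_algebra p d).
Hypothesis d_gt1 : (1 < d)%N.
Variable K : realType.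
Implicit Types (S : set A) (n : nat) (e : K).

Definition tratio S n : K := (tdim n S)%:R / (tdim n (rfree A))%:R.

Lemma tratio_unit S n : S `<=` rfree A -> 0 <= tratio S n <= 1.
Proof.
move=> SR; rewrite /tratio divr_ge0 //=.
have [->|R0] := posnP (tdim n (rfree A)); first by rewrite invr0 mulr0.
by rewrite ler_pdivrMr ?ltr0n // mul1r ler_nat leq_tdim.
Qed.

Let R n := tdim n (rfree A).

Lemma rfree_dimS n : R n.+1 = (R n + hdim n.+1 (rfree A))%N.
Proof. by apply: tdimS; [exact: submodule_rfree|exact: rfree_comp]. Qed.

Lemma rfree_dim_unbounded (c : nat) : exists N, forall n, (N <= n)%N -> (c <= R n)%N.
Proof.
have [N NP] := growth_pow p_prime A d_gt1 c; exists N.+1 => -[//|n] Nn.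
rewrite rfree_dimS; apply: leq_trans (leq_addl _ _).
apply: leq_trans (leq_hdim _ (@flie_rfree _ _ _)).
apply: leq_trans (NP _ (ltnW Nn)); rewrite leq_pmulr // expn_gt0.
by rewrite (ltnW d_gt1).
Qed.

Lemma rfree_dim_unboundedR (c : K) : exists N, forall n, (N <= n)%N -> c <= (R n)%:R.
Proof.
have [N NP] := rfree_dim_unbounded (Num.truncn c).+1; exists N => n /NP Rn.
by apply: le_trans (ltW (truncnS_gt c)) _; rewrite ler_nat.
Qed.

Lemma limn_inf_tratio S a : S `<=` rfree A ->
  (forall e, 0 < e -> exists N, forall n, (N <= n)%N ->
     (a - e) * (R n)%:R <= (tdim n S)%:R) ->
  (forall e N, 0 < e -> exists2 n, (N <= n)%N &
     (tdim n S)%:R <= (a + e) * (R n)%:R) ->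
  limn_inf (tratio S) = a.
Proof.
move=> SR lo hi; have [N1 R1] := rfree_dim_unbounded 1.
have R0 n : (N1 <= n)%N -> 0 < (R n)%:R :> K by move=> /R1; rewrite ltr0n.
apply: limn_inf_eq => [n|e e0|e N e0]; first exact: tratio_unit.
  have [N NP] := lo e e0; exists (maxn N1 N) => n; rewrite geq_max => /andP[n1 nN].
  by rewrite /tratio ler_pdivlMr ?R0 // NP.
have [n] := hi e (maxn N1 N) e0; rewrite geq_max => /andP[n1 nN] le_n.
by exists n => //; rewrite /tratio ler_pdivrMr ?R0.
Qed.

Lemma density_rfree : limn_inf (tratio (rfree A)) = 1.
Proof.
apply: limn_inf_tratio => // [e e0|e N e0].
  by exists 0%N => n _; rewrite ler_piMl // lerBlDr lerDl ltW.
by exists N => //; rewrite ler_peMl // lerDl ltW.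
Qed.

(** The low degrees of S contribute a constant, while dim R / R_(>n) is unbounded. *)
Lemma tdim_negligible S e : submodule S -> comp_closed S -> S `<=` rfree A ->
  (forall c : nat, exists N, forall n, (N <= n)%N ->
     (c * hdim n S <= hdim n (flie A))%N) ->
  0 < e -> exists N, forall n, (N <= n)%N -> (tdim n S)%:R <= e * (R n)%:R.
Proof.
(* One half of e pays for the degrees above N0, the other half for the constant T. *)
move=> Ss Sc SR Ssmall e0; pose c := (Num.truncn (2 / e)).+1.
have c0 : 0 < c%:R :> K by rewrite ltr0n.
have ce : 2 <= c%:R * e by rewrite -ler_pdivrMr // ltW // truncnS_gt.
have [N0 N0P] := Ssmall c; pose T := tdim N0 S.
have [N1 N1P] := rfree_dim_unboundedR (2 * T%:R / e).
exists (maxn N0 N1) => n; rewrite geq_max => /andP[n0 n1].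
have RT : 2 * T%:R <= e * (R n)%:R by rewrite [e * _]mulrC -ler_pdivrMr // N1P.
have cD : (c * tdim n S <= c * T + R n)%N.
  move: n0 {n1 RT} => /subnK <-; elim: (n - N0)%N => [|k IHk]; first exact: leq_addr.
  rewrite addSn tdimS // rfree_dimS mulnDr addnA leq_add //.
  apply: leq_trans (N0P _ _) (leq_hdim _ (@flie_rfree _ _ _)).
  by rewrite ltnW // ltnS leq_addl.
have {}cD : c%:R * (tdim n S)%:R <= c%:R * T%:R + (R n)%:R :> K.
  by rewrite -!natrM -natrD ler_nat.
rewrite -(ler_pM2l c0).
have R0 : 0 <= (R n)%:R :> K by [].
have ceR : 2 * (R n)%:R <= c%:R * e * (R n)%:R by rewrite ler_wpM2r.
have cRT : c%:R * (2 * T%:R) <= c%:R * (e * (R n)%:R) by rewrite ler_pM2l.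
lra.
Qed.

Variables (le : rel (bracket d)) (le_order : basic_order le).

Theorem density_basic (a : K) : 0 <= a <= 1 -> exists2 X : set (bracket d),
  (forall t, X t -> basic le t) & limn_inf (tratio (bracket_gen A X)) = a.
Proof.
(* For density 1 all generators are taken, s included, and S = R. The construction below divides by
   1 - a. *)
move=> /andP[a0]; rewrite le_eqVlt => /orP[/eqP ->|a1].
  exists [set t | exists i, t = Gen i]; first by move=> _ [i ->].
  rewrite -density_rfree; congr (limn_inf (tratio _)); rewrite /bracket_gen /rfree.
  congr (restricted_gen p _); apply/seteqP; split=> [_ [_ [i ->] <-]|_ [i _ <-]].
    by exists i.
  by exists (Gen i) => //; exists i.
have d0 : (0 < d)%N by exact: ltnW.
have sP : (d.-1 < d)%N by rewrite prednK.
pose s := Ordinal sP; have s_max (i : 'I_d) : (i <= s)%N by rewrite /= -ltnS prednK.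
have [X [Xmono Xnew Xgood Xle Xge]] :=
  greedy_sequence p_prime A le s (fun n => a * (R n)%:R).
pose U := \bigcup_n X n; pose S := bracket_gen A U; pose D n := tdim n S.
have XU n : X n `<=` U by move=> t Xt; exists n.
(* Brackets adjoined after stage n have weight above n and leave this dimension unchanged. *)
have DE n : D n = tdim n (bracket_gen A (X n)).
  apply/eqP; rewrite eqn_leq; apply/andP; split.
    by apply: tdim_high => // t [m _]; exact: Xnew.
  by apply: leq_tdim; apply: bracket_genS; exact: XU.
have Ss : submodule S := submodule_bracket_gen A U.
have Sc : comp_closed S := bracket_gen_comp p_prime (X := U).
have SR : S `<=` rfree A := @bracket_gen_rfree p d A U.
exists U; first by move=> t [n _ /Xgood[]].
apply: limn_inf_tratio => // e => [e0|N1 e0].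
(* The shortfall stays bounded: a stage either reaches the target, or takes all basic commutators,
   and then S grows by at least a times the growth of R. *)
- have [N0 N0P] : exists N, forall n, (N <= n)%N -> a * (R n)%:R <= (D n)%:R + (R N)%:R.
    (* This c makes the codimension bound d^(n/p) at most (1 - a) times the dimension of R in degree
       n. *)
    pose c := (Num.truncn (1 - a)^-1).+1.
    have ca : 1 <= c%:R * (1 - a).
      by rewrite -ler_pdivrMr ?subr_gt0 // div1r ltW // truncnS_gt.
    have [N NP] := growth_pow p_prime A d_gt1 c; exists N.+1 => n.
    have aR m : a * (R m)%:R <= (R m)%:R by rewrite ler_piMl // ltW.
    move=> /subnK <-; elim: (n - N.+1)%N => [|k IHk].
      by rewrite add0n (le_trans (aR _)) // lerDr.
    rewrite addSn; set m := (k + N.+1)%N in IHk *.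
    have [all|ge_m] := Xge m; last first.
      by rewrite DE (le_trans ge_m) // lerDl.
    have Sh : (hdim m.+1 (flie A) <= hdim m.+1 S)%N.
      apply: fdim_sub => u fu; exists (hcomp m.+1 u).
        have := basic_span_flie le_order (n := m.+1) fu.
        apply: (lspan_min Ss) => _ [t [bt tm] <-]; apply: sub_restricted_gen.
        (* The excluded letter s has weight 1, whereas m + 1 is at least 2. *)
        exists t => //; apply: (XU m.+1); apply: all => // ts.
        by move: tm; rewrite ts /= /m addnS.
      apply/rowP => j; rewrite !mxE wcoef_comp size_tuple eqxx; exact/esym/mulr1n.
    have rh := hdim_rfree p_prime A m.+1.
    have Nm : (N <= m.+1)%N by rewrite /m; lia.
    have cm := leq_trans (NP _ Nm) (leq_hdim m.+1 (@flie_rfree _ _ A)).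
    rewrite rfree_dimS /D tdimS // -/(D m) !natrD.
    have rh' : (hdim m.+1 (rfree A))%:R <= (hdim m.+1 S)%:R + (d ^ (m.+1 %/ p))%:R :> K.
      by rewrite -natrD ler_nat (leq_trans rh) // leq_add2r.
    have cm' : c%:R * (d ^ (m.+1 %/ p))%:R <= (hdim m.+1 (rfree A))%:R :> K.
      by rewrite -natrM ler_nat.
    have P0 : 0 <= (d ^ (m.+1 %/ p))%:R :> K by [].
    have H : (d ^ (m.+1 %/ p))%:R <= (1 - a) * (hdim m.+1 (rfree A))%:R.
      apply: le_trans (_ : (c%:R * (1 - a)) * (d ^ (m.+1 %/ p))%:R <= _).
        by rewrite ler_peMl.
      by rewrite -mulrA mulrCA ler_wpM2l // subr_ge0 ltW.
    lra.
  have [N2 N2P] := rfree_dim_unboundedR ((R N0)%:R / e).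
  exists (maxn N0 N2) => n; rewrite geq_max => /andP[n0 n2].
  have := N0P n n0; have := N2P n n2; rewrite ler_pdivrMr //; lra.
- apply: contrapT => noN.
  have big n : (N1 <= n)%N -> (a + e) * (R n)%:R < (D n)%:R.
    by move=> nN; rewrite ltNge; apply/negP => le_n; apply: noN; exists n.
  (* Once e dim R / R_(>n) is at least 1, exceeding (a + e) dim R / R_(>n) contradicts the bound a
     dim R / R_(>n) + 1 that holds after an adjunction, so nothing more is adjoined. *)
  have [N2 N2P] := rfree_dim_unboundedR (1 / e).
  pose N := maxn N1 N2.
  have stop n : (N <= n)%N -> X n.+1 `<=` X n.
    rewrite geq_max => /andP[n1 n2]; have [//|] := Xle n.
    rewrite -DE => le_n; have := big n.+1 (leqW n1).
    have := N2P n.+1 (leqW n2); rewrite ler_pdivrMr // => ? ?; exfalso; lra.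
  have UX : U `<=` X N.
    move=> t [n _]; have [/Xmono|Nn] := leqP n N; first exact.
    rewrite -(subnK (ltnW Nn)); elim: (n - N)%N => [|k IHk] //.
    by rewrite addSn => /stop; rewrite leq_addl => /(_ isT) /IHk.
  have SE : S `<=` block_alg A s N.+1.
    apply: restricted_gen_min; first exact: restricted_lie_block_alg.
    move=> _ [t /UX/Xgood[_ ts tN] <-].
    exact: block_algS (leqW tN) _ (block_alg_bval p_prime ts).
  (* Being negligible, S has dimension at most e dim R / R_(>n), which contradicts [big] because a
     >= 0. *)
  have [|N3 N3P] := @tdim_negligible S e Ss Sc SR _ e0.
    move=> c; have [N3 N3P] := growth_block_alg p_prime A d_gt1 c s_max (ltn0Sn N).
    exists N3 => n /N3P; apply: leq_trans.
    by rewrite leq_mul2l leq_hdim // orbT.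
  have n3 : (N3 <= maxn N1 N3)%N by exact: leq_maxr.
  have := big _ (leq_maxl N1 N3); have := N3P _ n3; rewrite -/(D _) mulrDl.
  have := mulr_ge0 a0 (ler0n K (R (maxn N1 N3))); lra.
Qed.

End Density.

(** * The free algebra of the statement *)

Section Coefficients.
Variables p d : nat.
Local Notation A := (free_alg p d).
Local Notation word := (seq 'I_d).
Implicit Types (u v : A) (w : word).

Definition fcoef w u : 'F_p := mcoeff (FMonom w) u.

Fact fcoef_is_linear w : linear_for *%R (fcoef w).
Proof. by move=> a u v; rewrite /fcoef mcoeffD mcoeffZ. Qed.

HB.instance Definition _ w :=
  GRing.isLinear.Build 'F_p A 'F_p *%R (fcoef w) (fcoef_is_linear w).

Lemma fcoefP u v : (forall w, fcoef w u = fcoef w v) -> u = v.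
Proof. by move=> uv; apply/malgP => k; have := uv (fmonom_val k); rewrite /fcoef fmK. Qed.

Lemma fcoef1 w : fcoef w 1 = (w == [::])%:R.
Proof. by rewrite /fcoef mcoeff1 fmP fm1. Qed.

Lemma fcoef_gen w (i : 'I_d) : fcoef w (gen p i) = (w == [:: i])%:R.
Proof. by rewrite /fcoef /gen mcoeffU1 fmP fmU eq_sym. Qed.

(** Both sides become sums over pairs of words in the supports; a pair with k1 k2 = w is seen only
    by the cut after k1. *)
Lemma fcoefM w u v :
  fcoef w (u * v) =
  \sum_(i < (size w).+1) fcoef (take i w) u * fcoef (drop i w) v.
Proof.
have fcoefE (g : A) (k : fmonom 'I_d) :
    mcoeff k g = \sum_(k1 <- finmap.enum_fset (msupp g)) mcoeff k1 g *+ (k1 == k).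
  rewrite {1}(monalgE g) raddf_sum /=.
  by apply: eq_bigr => k1 _; rewrite mcoeffU.
rewrite /fcoef mcoeffMl.
under [RHS]eq_bigr => i _.
  rewrite (fcoefE u) (fcoefE v) mulr_suml.
  under eq_bigr => k1 _ do rewrite mulr_sumr.
  over.
rewrite [RHS]exchange_big /=; apply: eq_bigr => k1 _.
rewrite [RHS]exchange_big /=; apply: eq_bigr => k2 _.
rewrite fmP fmM /=.
case: eqP => [<-|neq].
  have k1w : (size k1 < (size (k1 ++ k2)).+1)%N.
    by rewrite size_cat ltnS leq_addr.
  rewrite (bigD1 (Ordinal k1w)) //= take_size_cat // drop_size_cat //.
  rewrite !fmP /= !eqxx !mulr1n big1 ?addr0 // => i ni.
  have [e1|] := eqVneq k1 (FMonom (take i (k1 ++ k2))); last by rewrite mulr0n mul0r.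
  case/eqP: ni; apply/val_inj => /=.
  have := congr1 (fun k : fmonom 'I_d => size (fmonom_val k)) e1.
  by rewrite /= size_takel // -ltnS ltn_ord.
rewrite mulr0n big1 // => i _; rewrite mulrnAl mulrnAr.
have [e1|] := eqVneq k1; last by rewrite mulr0n.
have [e2|] := eqVneq k2; last by rewrite mulr0n.
by case: neq; rewrite e1 e2 /= cat_take_drop.
Qed.

Lemma fcoef_finite u : exists N, forall w, (N <= size w)%N -> fcoef w u = 0.
Proof.
exists (\max_(k <- finmap.enum_fset (msupp u)) (size (fmonom_val k)).+1)%N => w.
apply: contraTeq => cw; rewrite -ltnNge.
have ki : FMonom w \in finmap.enum_fset (msupp u) by rewrite -mcoeff_neq0.
exact: (@leq_bigmax_seq _ _ predT (fun k => (size (fmonom_val k)).+1) _ ki isT).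
Qed.

Definition free_word_algebra : word_algebra p d :=
  WordAlgebra fcoefP fcoef1 fcoef_gen fcoefM fcoef_finite.

End Coefficients.

Section FreeAlgebra.
Variables (p d : nat) (p_prime : prime p).
Local Notation A := (free_word_algebra p d).

Lemma word_spanE n : word_span n = [set u : A | homog n u] :> set (free_alg p d).
Proof.
apply/seteqP; split=> [_ [c ->] w nw|u hu].
  rewrite (raddf_sum (@wcoef p d A w)) big1 // => t _.
  rewrite [LHS](wcoefZ (A := A) w (c t) (monom A t)) wcoef_monom.
  have [wt|_] := eqVneq w t; last by rewrite mulr0.
  by rewrite wt size_tuple eqxx in nw.
exists (fun t : n.-tuple 'I_d => wcoef (w := A) (tval t) u).
apply: (wcoefP (w := A)) => w; rewrite -[RHS]/(wcoef w (hcomp n (u : A))) wcoef_comp.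
by have [_|/hu ->] := eqVneq (size w) n.
Qed.

Lemma bracket_valE t : bracket_val p t = bval A t.
Proof.
elim: t => [i|u IHu v IHv]; first reflexivity.
exact: (f_equal2 (@lie _ (free_alg p d)) IHu IHv).
Qed.

Lemma free_rlie_gtE n :
  @free_rlie_gt p d n = rfree A `&` [set u | ord_ge n.+1 u].
Proof.
have -> : @free_rlie_gt p d n = sum_gt (fun m => rfree A `&` [set u | homog m u]) n.
  by rewrite /free_rlie_gt; congr (sum_gt _ n); apply/funext => m; rewrite -word_spanE.
exact: (@sum_gt_homog p d A (rfree A) n (submodule_rfree A) (@rfree_comp p d p_prime A)).
Qed.

Lemma denE (K : realType) (S : set A) : submodule S -> S `<=` rfree A ->
  den K (S : set (free_alg p d)) = limn_inf (tratio K S).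
Proof.
move=> Ss SR; rewrite /den; congr (limn_inf _); apply/funext => n.
rewrite free_rlie_gtE; congr (_%:R / _%:R).
  exact: (quot_dim_tdim n Ss SR).
exact: (@quot_dim_rfree p d A n).
Qed.

Lemma gradedP (S : set A) : submodule S -> comp_closed S -> S `<=` rfree A ->
  graded (S : set (free_alg p d)).
Proof.
move=> Ss Sc SR; rewrite /graded.
have -> : (fun n => (S : set (free_alg p d)) `&` free_rlie_hom n) =
    (fun m => S `&` [set u : A | homog m u]).
  apply/funext => m; rewrite /free_rlie_hom word_spanE setIA.
  by congr (_ `&` _); apply/setIidPl.
apply: etrans (esym (@sum_gt_homog p d A S 0 Ss Sc)).
apply/esym/setIidPl => u /SR; exact: rfree_ord_ge.
Qed.

End FreeAlgebra.

Theorem corollary4p11 (K : realType) (p d : nat) (p_prime : prime p)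
    (d_ge2 : (2 <= d)%N) :
  (forall le : rel (bracket d), basic_order le ->
   forall alpha : K, 0 <= alpha <= 1 ->
   exists S : set (free_alg p d),
     [/\ rlie_subalg S,
         graded S,
         exists2 B : set (free_alg p d),
           B `<=` basic_commutators le & S = restricted_gen p B
       & den K S = alpha])
  /\ dspec p d K = [set alpha : K | 0 <= alpha <= 1].
Proof.
have part1 (le : rel (bracket d)) : basic_order le -> forall alpha : K, 0 <= alpha <= 1 ->
   exists S : set (free_alg p d),
     [/\ rlie_subalg S, graded S,
         exists2 B : set (free_alg p d),
           B `<=` basic_commutators le & S = restricted_gen p B
       & den K S = alpha].
  move=> le_order a a01; pose A := free_word_algebra p d.
  have [X Xbasic Xa] := density_basic p_prime A d_ge2 le_order a01.
  have Ss := submodule_bracket_gen A X.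
  have SR := @bracket_gen_rfree p d A X.
  exists (bracket_gen A X); split.
  - by split; [exact: restricted_gen_lie|exact: SR].
  - by apply: (gradedP p_prime Ss _ SR); exact: bracket_gen_comp.
  - exists (bval A @` X) => // _ [t /Xbasic bt <-].
    by exists t => //; rewrite bracket_valE.
  - by rewrite (denE p_prime K Ss SR).
split=> //; apply/seteqP; split=> [_ [S [SL SR] <-]|a a01].
  rewrite /= (denE p_prime K (S := S) (restricted_lie_submodule SL) SR).
  by apply: unit_seq_limn_inf => n; exact: tratio_unit.
(* The spectrum involves no order on commutators, so one has to be supplied. *)
have [le le_order] := basic_order_exists d.
by have [S [SL _ _ Sa]] := part1 le le_order a a01; exists S.
Qed.
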